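(* Let $\overline{a}_0,\overline{a}_1,\alpha_0,\alpha_1,\alpha_2,\beta_1,\xi_0,\xi_1,\xi_2,\zeta_0,\zeta_1,\zeta_2,\omega$ be real numbers with $\overline{a}_0\neq 0$, let $\varepsilon$ be a real parameter, and consider the Chua system $$ \dot x = a(z-bx-a_2x^2-a_1x^3),\qquad \dot y=-z,\qquad \dot z=-b_1x+y+b_2z $$ with parameters $$ \begin{array}{l} a=\overline{a}_0+\varepsilon\alpha_0+\varepsilon^2\xi_0,\\ a_1=\overline{a}_1+\varepsilon\alpha_1+\varepsilon^2\xi_1,\\ a_2=\varepsilon\alpha_2+\varepsilon^2\xi_2,\\ b=\dfrac{a_2^2}{4a_1}+\varepsilon^2\zeta_0,\\ b_1=\dfrac{\omega^2-1}{a}+\varepsilon\beta_1+\varepsilon^2\zeta_1,\\ b_2=\varepsilon^2\zeta_2. \end{array} $$ If $\overline{a}_1\omega\neq 0$ and $\overline{a}_1\zeta_0<0$, then for $\varepsilon>0$ sufficiently small the Chua system has a zero-Hopf bifurcation at the equilibrium point located at $$ p_-=\left(\frac{-a_2-\sqrt{a_2^2-4a_1b}}{2a_1},\ -\frac{a_2b_1}{2a_1}-\frac{b_1\sqrt{a_2^2-4a_1b}}{2a_1},\ 0\right), $$ and three limit cycles can bifurcate from this equilibrium when $\varepsilon=0$ (that is, there are choices of the real constants $\overline{a}_0,\overline{a}_1,\alpha_0,\alpha_1,\alpha_2,\beta_1,\xi_0,\xi_1,\xi_2,\zeta_0,\zeta_1,\zeta_2,\omega$ satisfying the hypotheses $\overline{a}_0\neq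 0$, $\overline{a}_1\omega\neq 0$ and $\overline{a}_1\zeta_0<0$ for which three limit cycles bifurcate from $p_-$). Moreover, for each $k\in\{1,2,3\}$ there exist choices of the real constants $\overline{a}_0,\overline{a}_1,\alpha_0,\alpha_1,\alpha_2,\beta_1,\xi_0,\xi_1,\xi_2,\zeta_0,\zeta_1,\zeta_2,\omega$ satisfying the hypotheses $\overline{a}_0\neq 0$, $\overline{a}_1\omega\neq 0$ and $\overline{a}_1\zeta_0<0$ for which $k$ limit cycles bifurcate simultaneously from $p_-$ when $\varepsilon=0$.
   Context: A zero-Hopf equilibrium is an equilibrium point of a 3-dimensional autonomous differential system whose linearization has a zero eigenvalue and a pair of purely imaginary (nonzero) eigenvalues. A system depending on parameters has a zero-Hopf bifurcation at an equilibrium if at the unperturbed parameter values (here $\varepsilon=0$, where $p_-$ is the origin) the equilibrium is a zero-Hopf equilibrium, and the dynamics in a small neighborhood of this equilibrium changes as the parameters vary near these values. A limit cycle is an isolated periodic orbit. One says that $k$ limit cycles bifurcate (simultaneously) from $p_-$ when $\varepsilon=0$ if for every sufficiently small $\varepsilon>0$ the system has $k$ distinct limit cycles, each tending to the equilibrium as $\varepsilon\to 0$. *)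

(* Defs.v *)
From HB Require Import structures.
From mathcomp Require Import all_boot all_order all_algebra.
From mathcomp Require Import complex.
From mathcomp Require Import all_classical all_reals all_analysis.

Set Implicit Arguments.
Unset Strict Implicit.
Unset Printing Implicit Defensive.

Import Order.TTheory GRing.Theory Num.Theory.
Import numFieldNormedType.Exports.

Local Open Scope classical_set_scope.
Local Open Scope ring_scope.
Local Open Scope complex_scope.

Section AutonomousSystems.
Variable R : realType.
Implicit Types X Y : 'rV[R]_3 -> 'rV[R]_3.

Definition solves X (I : set R) (g : R -> 'rV[R]_3) : Prop :=
  forall t, I t -> is_derive (t : R^o) 1 (g : R^o -> 'rV[R]_3) (X (g t)).

Definition periodic_orbit X (O : set 'rV[R]_3) : Prop :=
  exists (g : R -> 'rV[R]_3) (T : R),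
    [/\ solves X setT g, 0 < T, forall t, g (t + T) = g t,
        exists t, g t <> g 0 & O = range g].

(* Isolated means isolated among the periodic orbits: orbits that enter U but
   do not stay in it are not excluded. *)
Definition limit_cycle X (O : set 'rV[R]_3) : Prop :=
  periodic_orbit X O /\
  exists U : set 'rV[R]_3, [/\ open U, O `<=` U &
    forall O', periodic_orbit X O' -> O' `<=` U -> O' = O].

(* The eigenvalues are complex, hence the embedding of the real Jacobian
   matrix into matrices over R[i]; in dimension 3 the three eigenvalues below
   exhaust the spectrum. *)
Definition zero_hopf_equilibrium X (p : 'rV[R]_3) : Prop :=
  [/\ X p = 0, differentiable X p &
      exists2 w : R, w != 0 &
        let J := map_mx (real_complex R) ('J X p) in
        [/\ eigenvalue J 0, eigenvalue J (0 +i* w) &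
            eigenvalue J (0 -i* w)]].

(* Up to a time change s, h sends each solution arc of X lying in U to a
   solution arc of Y, with the same orientation. *)
Definition maps_orbits X (U : set 'rV[R]_3) Y (h : 'rV[R]_3 -> 'rV[R]_3) :
    Prop :=
  forall (I : set R) (g : R -> 'rV[R]_3),
    open I -> is_interval I -> solves X I g -> g @` I `<=` U ->
    exists (s : R -> R) (g' : R -> 'rV[R]_3),
      [/\ {within I, continuous s},
          forall t u, I t -> I u -> t < u -> s t < s u,
          solves Y (s @` I) g' &
          forall t, I t -> h (g t) = g' (s t)].

Definition topologically_equivalent X (U : set 'rV[R]_3)
    Y (V : set 'rV[R]_3) : Prop :=
  exists h k : 'rV[R]_3 -> 'rV[R]_3,
    [/\ {within U, continuous h} /\ {within V, continuous k},
        forall x, U x -> V (h x) /\ k (h x) = x,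
        forall y, V y -> U (k y) /\ h (k y) = y,
        maps_orbits X U Y h &
        maps_orbits Y V X k].

(* In the definitions below, X e is the vector field at parameter value e, and
   p e is the equilibrium under consideration.  The neighborhoods U and V of
   p 0 are chosen before e: if they could shrink with e, changes such as the
   birth of another equilibrium close to p e would go unnoticed. *)
Definition zero_hopf_bifurcation
    (X : R -> 'rV[R]_3 -> 'rV[R]_3) (p : R -> 'rV[R]_3) : Prop :=
  [/\ zero_hopf_equilibrium (X 0) (p 0),
      \forall e \near 0^'+, X e (p e) = 0,
      p e @[e --> 0^'+] --> p 0 &
      exists2 W, nbhs (p 0) W &
        forall U V, open_nbhs (p 0) U -> open_nbhs (p 0) V ->
          U `<=` W -> V `<=` W ->
          \forall e \near 0^'+, ~ topologically_equivalent (X e) U (X 0) V].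

Definition limit_cycles_bifurcate (k : nat)
    (X : R -> 'rV[R]_3 -> 'rV[R]_3) (p : R -> 'rV[R]_3) : Prop :=
  exists C : 'I_k -> R -> set 'rV[R]_3,
    (\forall e \near 0^'+,
       injective (C ^~ e) /\ forall i, limit_cycle (X e) (C i e)) /\
    forall i N, nbhs (p 0) N -> \forall e \near 0^'+, C i e `<=` N.

End AutonomousSystems.

Section Chua.
Variable R : realType.

Definition vec3 (x y z : R) : 'rV[R]_3 := \row_(i < 3) [:: x; y; z]`_i.

Definition chua (a a1 a2 b b1 b2 : R) (v : 'rV[R]_3) : 'rV[R]_3 :=
  let x := v 0 0 in let y := v 0 1 in let z := v 0 2 in
  vec3 (a * (z - b * x - a2 * x ^+ 2 - a1 * x ^+ 3))
       (- z)
       (- b1 * x + y + b2 * z).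

Record chua_constants := ChuaConstants {
  abar0 : R; abar1 : R;
  alpha0 : R; alpha1 : R; alpha2 : R;
  beta1 : R;
  xi0 : R; xi1 : R; xi2 : R;
  zeta0 : R; zeta1 : R; zeta2 : R;
  omega : R }.

Definition admissible (c : chua_constants) : Prop :=
  [/\ abar0 c != 0, abar1 c * omega c != 0 & abar1 c * zeta0 c < 0].

Variable c : chua_constants.

Definition par_a (e : R) : R := abar0 c + e * alpha0 c + e ^+ 2 * xi0 c.
Definition par_a1 (e : R) : R := abar1 c + e * alpha1 c + e ^+ 2 * xi1 c.
Definition par_a2 (e : R) : R := e * alpha2 c + e ^+ 2 * xi2 c.
Definition par_b (e : R) : R :=
  par_a2 e ^+ 2 / (4 * par_a1 e) + e ^+ 2 * zeta0 c.
Definition par_b1 (e : R) : R :=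
  (omega c ^+ 2 - 1) / par_a e + e * beta1 c + e ^+ 2 * zeta1 c.
Definition par_b2 (e : R) : R := e ^+ 2 * zeta2 c.

Definition chua_family (e : R) : 'rV[R]_3 -> 'rV[R]_3 :=
  chua (par_a e) (par_a1 e) (par_a2 e) (par_b e) (par_b1 e) (par_b2 e).

Definition discr (e : R) : R := par_a2 e ^+ 2 - 4 * par_a1 e * par_b e.

Definition p_minus (e : R) : 'rV[R]_3 :=
  vec3 ((- par_a2 e - Num.sqrt (discr e)) / (2 * par_a1 e))
       (- (par_a2 e * par_b1 e / (2 * par_a1 e))
        - par_b1 e * Num.sqrt (discr e) / (2 * par_a1 e))
       0.

End Chua.

(* Main.v *)
Require Import Defs.
From mathcomp Require Import all_boot all_order all_algebra.
From mathcomp Require Import complex.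
From mathcomp Require Import all_classical all_reals all_analysis.
From mathcomp Require Import ring lra.

Import Order.TTheory GRing.Theory Num.Theory.
Import numFieldNormedType.Exports.

Local Open Scope classical_set_scope.
Local Open Scope ring_scope.

Set Implicit Arguments.
Unset Strict Implicit.
Unset Printing Implicit Defensive.

(* Zero-Hopf bifurcation: at e = 0 the origin is the only equilibrium, whereas for
   small e > 0 there are at least two equilibria near it; a topological
   equivalence sends constant solutions to constant solutions, so it cannot exist.

   Limit cycles: for a suitable choice of the constants the system is odd, and in
   rescaled cylindrical coordinates (m, rho, th) it is a perturbation of size
   mu = e ^ 2 of a rotation.  Averaging over th gives the gradient flow of
     Psi (m, rho) = - (m^2 + rho^2 / 2) / 2 + (m^4 + 3 m^2 rho^2 + 3 rho^4 / 8) / 4,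
   which has three critical points with rho > 0, all nondegenerate:
   (0, sqrt (4/3)) and (+- sqrt (1/5), sqrt (8/15)).  Near each of them a 2 pi-periodic
   solution of the equation with independent variable th is the fixed point of a
   contraction combining a Newton step for the initial value with a Picard
   integral.  It is isolated because the Hessian form of Psi at the critical
   point, evaluated on the difference of two solutions at equal angles and
   corrected at order mu, is a strict Lyapunov function: any complete orbit
   staying near the critical point coincides with the periodic one. *)

(** * Primitives and averages *)

(** A limit cycle must be isolated among all periodic orbits in a neighborhood, including those that
    close up only after several turns; uniqueness of a fixed point of the return map would not
    exclude these. The isolation argument therefore treats an arbitrary complete orbit in a box. The
    critical points (+- sqrt (1/5), sqrt (8/15)) are saddles of [Psi]: the Hessian there has
    determinant -4/5, so the Lyapunov function is indefinite and attraction arguments fail. Only its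
    derivative has a sign, the leading term being minus the squared norm of the Hessian applied to
    the difference; boundedness in both time directions then takes the place of positivity. The
    contraction factor does not depend on mu, and any positive decay rate suffices for isolation.
    Hence the boxes have a fixed size in rescaled coordinates, and shrink like e in the original
    ones. *)

Section ContinuousFunctions.
Variables (R : realType) (T : topologicalType).
Implicit Types f g : T -> R.

Lemma continuous_mulfun f g :
  continuous f -> continuous g -> continuous (fun x => f x * g x).
Proof. by move=> cf cg x; apply: cvgM; [exact: cf|exact: cg]. Qed.

Lemma continuous_addfun f g :
  continuous f -> continuous g -> continuous (fun x => f x + g x).
Proof. by move=> cf cg x; apply: cvgD; [exact: cf|exact: cg]. Qed.

Lemma continuous_oppfun f : continuous f -> continuous (fun x => - f x).
Proof. by move=> cf x; apply: cvgN; exact: cf. Qed.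

Lemma continuous_subfun f g :
  continuous f -> continuous g -> continuous (fun x => f x - g x).
Proof. by move=> cf cg; exact/continuous_addfun/continuous_oppfun. Qed.

Lemma continuous_cstfun (a : R) : continuous (fun _ : T => a).
Proof. by move=> x; exact: cvg_cst. Qed.

Lemma continuous_sqrfun f : continuous f -> continuous (fun x => f x ^+ 2).
Proof.
by move=> cf; under eq_fun do rewrite expr2; exact: continuous_mulfun.
Qed.

Lemma continuous_invfun f : (forall x, f x != 0) -> continuous f ->
  continuous (fun x => (f x)^-1).
Proof. by move=> f0 cf x; apply: cvgV; [exact: f0|exact: cf]. Qed.

Lemma continuous_cosfun f : continuous f -> continuous (fun x => cos (f x)).
Proof.
by move=> cf x; apply: continuous_comp; [exact: cf|exact: continuous_cos].
Qed.

Lemma continuous_sinfun f : continuous f -> continuous (fun x => sin (f x)).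
Proof.
by move=> cf x; apply: continuous_comp; [exact: cf|exact: continuous_sin].
Qed.

End ContinuousFunctions.

Section Primitives.
Variable R : realType.
Implicit Types f g F : R -> R.

Lemma is_derive_continuous f (df : R -> R) :
  (forall x : R, is_derive x 1 f (df x)) -> continuous f.
Proof.
move=> fdf x; apply/differentiable_continuous/derivable1_diffP.
by have [] := fdf x.
Qed.

Lemma mean_value f df a b : a <= b -> (forall x : R, is_derive x 1 f (df x)) ->
  exists2 c, a <= c <= b & f b - f a = df c * (b - a).
Proof.
move=> ab fdf.
have cf := is_derive_continuous fdf.
have [c cab ->] :=
  MVT_segment ab (fun x _ => fdf x) (continuous_subspaceT cf).
by exists c => //; rewrite in_itv in cab.
Qed.

Lemma norm_increment f df C a b : a <= b ->
  (forall x : R, is_derive x 1 f (df x)) ->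
  (forall x, a <= x <= b -> `|df x| <= C) -> `|f b - f a| <= C * (b - a).
Proof.
move=> ab fdf dfC; have [c cab ->] := mean_value ab fdf.
by rewrite normrM (ger0_norm (x := b - a)) ?subr_ge0// ler_wpM2r ?subr_ge0// dfC.
Qed.

Lemma derive0_constant f : (forall x : R, is_derive x 1 f 0) ->
  forall x y, f x = f y.
Proof.
move=> f0; suff H x y : x <= y -> f x = f y.
  by move=> x y; have [/H//|/ltW/H] := leP x y.
by move=> /mean_value /(_ f0) [c _ /eqP]; rewrite mul0r subr_eq0 => /eqP.
Qed.

Lemma eq_primitive f F G : (forall x : R, is_derive x 1 F (f x)) ->
  (forall x : R, is_derive x 1 G (f x)) -> forall x, F x - F 0 = G x - G 0.
Proof.
move=> dF dG x.
have /derive0_constant/(_ x 0) : forall x : R, is_derive x 1 (F \- G) 0.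
  move=> y; have := dF y; have := dG y => *.
  by apply: is_derive_eq; rewrite subrr.
by move=> /= ?; lra.
Qed.

Lemma continuous_primitive_on f (a : R) : continuous f ->
  exists F : R -> R, forall x : R, a < x -> is_derive x 1 F (f x).
Proof.
move=> cf.
exists (fun x => \int[lebesgue_measure]_(t in `[a, x]) f t)%R => x ax.
have [||dF <-] := @continuous_FTC1 R f (BLeft a) x (x + 1) _ _ ax (cf x).
- by rewrite ltrDl.
- apply: continuous_compact_integrable; first exact: segment_compact.
  exact: continuous_subspaceT.
- by rewrite derive1E; exact: derivableP.
Qed.

(** Primitives on the half-lines x > - (n + 1), normalized to vanish at 0, agree on overlaps by the
    mean value theorem, hence glue to a primitive on the whole line. *)
Lemma continuous_primitive f : continuous f ->
  exists2 F : R -> R, F 0 = 0 & forall x : R, is_derive x 1 F (f x).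
Proof.
move=> cf.
have /choice [G GP] : forall n : nat, exists F : R -> R,
    F 0 = 0 /\ forall x : R, - n.+1%:R < x -> is_derive x 1 F (f x).
  move=> n; have [F FP] := @continuous_primitive_on f (- n.+1%:R) cf.
  exists (F \- cst (F 0)); split=> [/=|x nx]; first by rewrite subrr.
  by have := FP _ nx => ?; apply: is_derive_eq; rewrite subr0.
have Geq n m x : - n.+1%:R < x -> - m.+1%:R < x -> G n x = G m x.
  move=> nx mx.
  have [Gn0 Gn] := GP n; have [Gm0 Gm] := GP m.
  pose D := G n \- G m.
  pose a := Num.min x 0; pose b := Num.max x 0.
  have dD y : y \in `[a, b] -> is_derive y 1 D 0.
    rewrite in_itv/= => /andP[ay _].
    have n0 k : - k.+1%:R < 0 :> R by rewrite oppr_lt0.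
    have ny : - n.+1%:R < y by rewrite (lt_le_trans _ ay)// lt_min nx n0.
    have my : - m.+1%:R < y by rewrite (lt_le_trans _ ay)// lt_min mx n0.
    have := Gn _ ny; have := Gm _ my => *.
    by apply: is_derive_eq; rewrite subrr.
  have ab : a <= b by rewrite ge_min le_max lexx.
  have dD' y : y \in `]a, b[ -> is_derive y 1 D 0.
    by rewrite in_itv/= => /andP[ay yb]; apply: dD; rewrite in_itv/= !ltW.
  have cD : {within `[a, b], continuous D}.
    by apply: derivable_within_continuous => z /dD[].
  have [c _] := MVT_segment ab dD' cD.
  rewrite mul0r /a /b; case: (leP x 0) => x0.
    by rewrite /D/= Gn0 Gm0 subrr sub0r => /eqP; rewrite oppr_eq0 subr_eq0 => /eqP.
  by rewrite /D/= Gn0 Gm0 subrr subr0 => /eqP; rewrite subr_eq0 => /eqP.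
pose N (x : R) := Num.truncn `|x|.
have NP x : - (N x).+1%:R < x.
  by rewrite ltrNl (le_lt_trans (ler_norm _))// normrN /N truncnS_gt.
exists (fun x => G (N x) x) => [|x]; first by case: (GP (N 0)).
have := (GP (N x)).2 _ (NP x).
apply: near_eq_is_derive; near=> y.
apply: Geq => //; near: y.
exact: lt_nbhsr (NP x).
Unshelve. all: by end_near. Qed.

End Primitives.

Section Averages.
Variable R : realType.
Implicit Types f g F : R -> R.

Definition turn : R := pi *+ 2.

Lemma turn_gt0 : 0 < turn.
Proof. by rewrite /turn mulrn_wgt0// pi_gt0. Qed.

Lemma turn_le8 : turn <= 8.
Proof. by have h := @pihalf_lt2 R; rewrite /turn mulr2n; lra. Qed.

Lemma periodicz f (T : R) : periodic f T -> forall (n : int) a, f (a + T *~ n) = f a.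
Proof.
move=> fT [n|n] a; first exact: periodicn.
by rewrite NegzE mulrNz -[in RHS](subrK (T *~ n.+1) a) -[T *~ n.+1]/(T *+ n.+1) periodicn.
Qed.

Lemma periodic_reduce f x : periodic f turn ->
  exists2 y, 0 <= y <= turn & f x = f y.
Proof.
move=> fT; pose n := Num.floor (x / turn).
exists (x + turn *~ (- n)); last by rewrite periodicz.
have t0 := turn_gt0.
have : n%:~R <= x / turn < n%:~R + 1.
  by have := floor_itv (x / turn); rewrite intrD.
rewrite ler_pdivlMr// ltr_pdivrMr// mulrNz -mulrzl mulrDl mul1r => /andP[h1 h2].
by apply/andP; split; lra.
Qed.

(** Choosing with [xget] makes [prim] total; the default value is only reached when no primitive
    exists. *)
Definition prim f : R -> R :=
  xget (fun=> 0) [set F | F 0 = 0 /\ forall x : R, is_derive x 1 F (f x)].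
Definition avg f : R := prim f turn / turn.
(** Primitive of the oscillating part [f - avg f]; it is periodic when [f] is, which makes it the
    usual corrector of averaging theory. *)
Definition hat f (x : R) : R := prim f x - avg f * x.

Lemma prim_spec f : continuous f ->
  prim f 0 = 0 /\ forall x : R, is_derive x 1 (prim f) (f x).
Proof.
by move=> /continuous_primitive [F F0 dF]; rewrite /prim; case: xgetP => // /(_ F)[].
Qed.

Lemma primE f F : (forall x : R, is_derive x 1 F (f x)) ->
  forall x, prim f x = F x - F 0.
Proof.
move=> dF x; rewrite /prim; case: xgetP => [G _ [G0 dG]|].
  by rewrite -(eq_primitive dG dF) G0 subr0.
move=> /(_ (F \- cst (F 0))) []; split; first by rewrite /= subrr.
by move=> y; have := dF y => ?; apply: is_derive_eq; rewrite subr0.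
Qed.

Lemma avgE f F : (forall x : R, is_derive x 1 F (f x)) ->
  avg f = (F turn - F 0) / turn.
Proof. by move=> /primE; rewrite /avg => ->. Qed.

Lemma primB f g : continuous f -> continuous g ->
  forall x, prim (f \- g) x = prim f x - prim g x.
Proof.
move=> /prim_spec[f0 df] /prim_spec[g0 dg] x.
have dfg (y : R) : is_derive y 1 (prim f \- prim g) ((f \- g) y).
  by have := df y; have := dg y => *; exact: is_derive_eq.
by rewrite (primE dfg)/= f0 g0 subrr subr0.
Qed.

Lemma avgB f g : continuous f -> continuous g -> avg (f \- g) = avg f - avg g.
Proof. by move=> cf cg; rewrite /avg primB// mulrBl. Qed.

Lemma hatB f g : continuous f -> continuous g ->
  forall x, hat (f \- g) x = hat f x - hat g x.
Proof. by move=> cf cg x; rewrite /hat primB// avgB//; ring. Qed.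

Lemma avgD f g : continuous f -> continuous g ->
  avg (fun x => f x + g x) = avg f + avg g.
Proof.
move=> /prim_spec[f0 df] /prim_spec[g0 dg].
have dfg (y : R) : is_derive y 1 (prim f \+ prim g) (f y + g y).
  by have := df y; have := dg y => *; exact: is_derive_eq.
by rewrite (avgE dfg)/= f0 g0 addr0 subr0 mulrDl.
Qed.

Lemma avgZ (a : R) f : continuous f -> avg (fun x => a * f x) = a * avg f.
Proof.
move=> /prim_spec[f0 df].
have daf (y : R) : is_derive y 1 (fun x => a * prim f x) (a * f y).
  by have := df y => ?; apply: is_derive_eq.
by rewrite (avgE daf) f0 mulr0 subr0 /avg mulrA.
Qed.

Lemma is_derive_hat f : continuous f ->
  forall x : R, is_derive x 1 (hat f) (f x - avg f).
Proof.
move=> /prim_spec[_ df] x; have := df x => ?.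
by apply: is_derive_eq; rewrite /GRing.scale/= mulr1.
Qed.

Lemma hat0 f : continuous f -> hat f 0 = 0.
Proof. by move=> /prim_spec[f0 _]; rewrite /hat f0 mulr0 subr0. Qed.

Lemma hat_turn f : hat f turn = 0.
Proof. by rewrite /hat /avg divfK ?subrr// gt_eqF// turn_gt0. Qed.

Lemma avg_norm f (C : R) : continuous f -> (forall x, `|f x| <= C) ->
  `|avg f| <= C.
Proof.
move=> /prim_spec[f0 df] fC; rewrite /avg normrM normfV.
rewrite (gtr0_norm turn_gt0) ler_pdivrMr ?turn_gt0//.
by have := norm_increment (ltW turn_gt0) df (fun x _ => fC x); rewrite f0 !subr0 => h.
Qed.

Lemma hat_periodic f : continuous f -> periodic f turn -> periodic (hat f) turn.
Proof.
move=> cf fT x; apply/eqP; rewrite -subr_eq0; apply/eqP.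
pose g := (fun y => hat f (y + turn)) \- hat f.
have dg (y : R) : is_derive y 1 g 0.
  have := is_derive_hat cf y => df1.
  have := is_derive_hat cf (y + turn) => df2.
  have : is_derive y 1 (hat f \o (fun z => z + turn)) ((f (y + turn) - avg f) * 1).
    apply: is_derive1_comp.
    by apply: is_derive_eq; rewrite addr0.
  move=> df3.
  by apply: is_derive_eq; rewrite fT mulr1 subrr.
rewrite -[LHS]/(g x) (derive0_constant dg x 0) /g/= add0r hat_turn.
by rewrite hat0// subrr.
Qed.

(** By periodicity one turn is enough: its length is at most 8, and the integrand [f - avg f] is at
    most 2 C. *)
Lemma hat_norm f (C : R) : continuous f -> periodic f turn ->
  (forall x, `|f x| <= C) -> forall x, `|hat f x| <= 16 * C.
Proof.
move=> cf fT fC x.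
have [y /andP[y0 yt] ->] := periodic_reduce x (hat_periodic cf fT).
have C0 : 0 <= C by rewrite (le_trans _ (fC 0)).
have dC z : 0 <= z <= y -> `|f z - avg f| <= 2 * C.
  by move=> _; rewrite (le_trans (ler_normB _ _))// mulr_natl mulr2n lerD// avg_norm.
have := norm_increment y0 (is_derive_hat cf) dC; rewrite hat0// !subr0 => h.
have := turn_le8 => h8; nra.
Qed.

End Averages.

(** * The vector field in polar coordinates *)

Section PolarField.
Variable R : realType.
Implicit Types (mu th m rho : R).

Definition cubic (x : R) : R := x ^+ 3 - x.

Lemma continuous_cubicfun (T : topologicalType) (f : T -> R) :
  continuous f -> continuous (fun x => cubic (f x)).
Proof.
move=> cf; rewrite /cubic; under eq_fun do rewrite !exprS expr0 mulr1.
apply: continuous_subfun => //; apply: continuous_mulfun => //.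
exact: continuous_mulfun.
Qed.

(* In the coordinates of [polar_point] below, and after a time change, the
   chosen Chua system reads m' = - mu P, w' = - z + mu P, z' = w, where
   P = cubic (m - w) and mu = e ^ 2.  With w = rho cos th and z = rho sin th, its
   orbits are the solutions of
     dm / dth = - mu * polar_rate,  drho / dth = mu * cos th * polar_rate. *)
Definition polar_denom mu th m rho : R :=
  rho - mu * sin th * cubic (m - rho * cos th).

Definition polar_rate mu th m rho : R :=
  cubic (m - rho * cos th) * rho / polar_denom mu th m rho.

Definition box_radius : R := 1 / (4 * 10 ^+ 3).

Lemma box_radius_bounds : 0 < box_radius <= 1 / 100.
Proof. by rewrite /box_radius; apply/andP; split; lra. Qed.

Definition in_box (c : R * R) m rho : Prop :=
  `|m - c.1| <= box_radius /\ `|rho - c.2| <= box_radius.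

(* [box_radius] and the bound in [mu_small] are only chosen small enough for the
   crude estimates that follow. *)
Definition center_ok (c : R * R) : Prop := `|c.1| <= 1 /\ 1 / 2 <= c.2 <= 2.

Definition mu_small mu : Prop := 0 < mu <= 1 / 10 ^+ 12.

(* The derivative of [cubic] at the position m - rho cos th of the center. *)
Definition slope (c : R * R) th : R := 3 * (c.1 - c.2 * cos th) ^+ 2 - 1.

Lemma normM_le (a b A B : R) : `|a| <= A -> `|b| <= B -> `|a * b| <= A * B.
Proof. by move=> aA bB; rewrite normrM ler_pM. Qed.

Lemma normB_le (a b A B : R) : `|a| <= A -> `|b| <= B -> `|a - b| <= A + B.
Proof. by move=> aA bB; rewrite (le_trans (ler_normB _ _))// lerD. Qed.

Lemma normD_le (a b A B : R) : `|a| <= A -> `|b| <= B -> `|a + b| <= A + B.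
Proof. by move=> aA bB; rewrite (le_trans (ler_normD _ _))// lerD. Qed.

Lemma in_box_center c : in_box c c.1 c.2.
Proof. by split; have /andP[? _] := box_radius_bounds; rewrite subrr normr0 ltW. Qed.

Lemma cos_combination_norm th (a b : R) : `|a - cos th * b| <= `|a| + `|b|.
Proof. by apply: normB_le => //; rewrite -[leRHS]mul1r normM_le// cos_max. Qed.

Lemma slope_norm c th : center_ok c -> `|slope c th| <= 26.
Proof.
move=> [c1 /andP[c2 c2']].
have : `|c.1 - c.2 * cos th| <= 3.
  rewrite (_ : 3 = 1 + 2 * 1); last by ring.
  by rewrite normB_le// normM_le ?cos_max// ger0_norm//; lra.
rewrite /slope; set x := _ - _; rewrite !ler_norml => /andP[x3 x3'].
by apply/andP; split; nra.
Qed.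

Section box.
Variables (c : R * R) (th m rho : R).
Hypotheses (cok : center_ok c) (b : in_box c m rho).

Let x := m - rho * cos th.

Lemma box_rho : 49 / 100 <= rho <= 201 / 100.
Proof.
case: cok => _ /andP[? ?]; case: b => _.
have /andP[? ?] := box_radius_bounds; rewrite ler_norml => /andP[? ?].
by apply/andP; split; lra.
Qed.

Lemma box_m : `|m| <= 101 / 100.
Proof.
case: cok; rewrite ler_norml => /andP[? ?] _; case: b => + _.
have /andP[? ?] := box_radius_bounds; rewrite !ler_norml => /andP[? ?].
by apply/andP; split; lra.
Qed.

Lemma box_x : `|x| <= 4.
Proof.
have /andP[r1 r2] := box_rho.
apply: (@le_trans _ _ (101 / 100 + 201 / 100 * 1)); last by lra.
by rewrite normB_le ?box_m// normM_le ?cos_max// ger0_norm//; lra.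
Qed.

Lemma box_x_center : `|x - (c.1 - c.2 * cos th)| <= 2 * box_radius.
Proof.
rewrite (_ : _ - _ = (m - c.1) - cos th * (rho - c.2)); last by rewrite /x; ring.
by case: b => b1 b2; rewrite (le_trans (cos_combination_norm _ _ _))//; lra.
Qed.

Lemma box_cubic : `|cubic x| <= 68.
Proof.
rewrite (_ : 68 = 4 ^+ 3 + 4); last by ring.
by rewrite normB_le ?box_x// normrX lerXn2r// ?nnegrE// box_x.
Qed.

Lemma box_denom mu : mu_small mu -> 48 / 100 <= polar_denom mu th m rho.
Proof.
move=> /andP[mu0 mu1]; have /andP[r1 r2] := box_rho.
have : `|mu * sin th * cubic x| <= 1 / 10 ^+ 12 * 1 * 68.
  by rewrite !normM_le// ?box_cubic ?sin_max// gtr0_norm.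
by rewrite /polar_denom -/x ler_norml => /andP[h1 h2]; lra.
Qed.

Lemma box_denom_gt0 mu : mu_small mu -> 0 < polar_denom mu th m rho.
Proof. by move=> /box_denom; apply: lt_le_trans; lra. Qed.

End box.

Definition rate_defect mu th m rho : R :=
  sin th * (cubic (m - rho * cos th) ^+ 2 / polar_denom mu th m rho).

(** Replace the factor rho of the numerator by the denominator plus mu sin th P: the denominator
    cancels in the first term. *)
Lemma polar_rateE c mu th m rho : center_ok c -> in_box c m rho -> mu_small mu ->
  polar_rate mu th m rho =
  cubic (m - rho * cos th) + mu * rate_defect mu th m rho.
Proof.
move=> cok b mus; have := box_denom_gt0 th cok b mus.
rewrite /polar_rate /rate_defect => d0.
have dn0 : polar_denom mu th m rho != 0 by rewrite gt_eqF.
have e : rho = polar_denom mu th m rho + mu * sin th * cubic (m - rho * cos th).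
  by rewrite /polar_denom; ring.
move: dn0 e; set D := polar_denom _ _ _ _; set P := cubic _ => dn0 e.
by rewrite [X in P * X]e; field.
Qed.

Lemma denomV_norm c mu th m rho : center_ok c -> in_box c m rho -> mu_small mu ->
  `|(polar_denom mu th m rho)^-1| <= 3.
Proof.
move=> cok b mus; have d := box_denom th cok b mus.
rewrite normfV ger0_norm; last by lra.
by rewrite -[leRHS]invrK lef_pV2 ?posrE; lra.
Qed.

Lemma rate_defect_norm c mu th m rho :
  center_ok c -> in_box c m rho -> mu_small mu ->
  `|rate_defect mu th m rho| <= 15 * 10 ^+ 3.
Proof.
move=> cok b mus.
apply: (@le_trans _ _ (1 * (68 ^+ 2 * 3))); last by lra.
rewrite normM_le ?sin_max// normM_le ?(denomV_norm th cok b mus)//.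
by rewrite normrX lerXn2r ?nnegrE ?(box_cubic th cok b)//; lra.
Qed.

(** The divided difference of [cubic] is x1^2 + x1 x2 + x2^2 - 1, and each of its three quadratic
    terms differs from the square at the center by at most 16 [box_radius]. *)
Lemma cubicB c th m1 rho1 m2 rho2 :
  center_ok c -> in_box c m1 rho1 -> in_box c m2 rho2 ->
  `|cubic (m1 - rho1 * cos th) - cubic (m2 - rho2 * cos th)
     - slope c th * ((m1 - m2) - cos th * (rho1 - rho2))|
    <= 48 * box_radius * (`|m1 - m2| + `|rho1 - rho2|).
Proof.
move=> cok b1 b2.
have := box_x th cok b1; have := box_x th cok b2.
have := box_x_center th b1; have := box_x_center th b2.
have : `|c.1 - c.2 * cos th| <= 4 by exact: box_x cok (in_box_center c).
set x1 := m1 - _; set x2 := m2 - _; set x0 := c.1 - _ => h0 h20 h10 h2 h1.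
have sq y : `|y| <= 4 -> `|y - x0| <= 2 * box_radius ->
    `|y ^+ 2 - x0 ^+ 2| <= 2 * box_radius * 8.
  move=> y4 yx; rewrite subr_sqr normM_le//.
  by rewrite (le_trans (normD_le y4 h0))//; lra.
have pr : `|x1 * x2 - x0 ^+ 2| <= 2 * box_radius * 8.
  rewrite (_ : _ - _ = (x1 - x0) * x2 + x0 * (x2 - x0)); last by ring.
  by rewrite (le_trans (normD_le (normM_le h10 h2) (normM_le h0 h20)))//; lra.
rewrite (_ : _ - _ = ((x1 ^+ 2 - x0 ^+ 2) + (x2 ^+ 2 - x0 ^+ 2) + (x1 * x2 - x0 ^+ 2))
   * ((m1 - m2) - cos th * (rho1 - rho2))); last first.
  by rewrite /cubic /slope -/x0 /x1 /x2; ring.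
rewrite normM_le ?cos_combination_norm//.
rewrite (_ : 48 * box_radius =
  2 * box_radius * 8 + 2 * box_radius * 8 + 2 * box_radius * 8); last by ring.
by rewrite !normD_le// sq.
Qed.

Lemma cubic_lip c th m1 rho1 m2 rho2 :
  center_ok c -> in_box c m1 rho1 -> in_box c m2 rho2 ->
  `|cubic (m1 - rho1 * cos th) - cubic (m2 - rho2 * cos th)|
    <= 27 * (`|m1 - m2| + `|rho1 - rho2|).
Proof.
move=> cok b1 b2; have := cubicB th cok b1 b2.
set D := _ - cubic _; set l := (m1 - m2) - _ => h.
have := normM_le (slope_norm th cok) (cos_combination_norm th (m1 - m2) (rho1 - rho2)).
rewrite -/l => h2.
rewrite (_ : D = (D - slope c th * l) + slope c th * l); last by ring.
rewrite (le_trans (normD_le h h2))// -mulrDl ler_wpM2r ?addr_ge0//.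
by rewrite /box_radius; lra.
Qed.

Lemma rate_defectB c mu th m1 rho1 m2 rho2 :
  center_ok c -> in_box c m1 rho1 -> in_box c m2 rho2 -> mu_small mu ->
  `|rate_defect mu th m1 rho1 - rate_defect mu th m2 rho2|
    <= 10 ^+ 7 * (`|m1 - m2| + `|rho1 - rho2|).
Proof.
move=> cok b1 b2 mus.
have lip := cubic_lip th cok b1 b2.
have p1 := box_cubic th cok b1; have p2 := box_cubic th cok b2.
have d1 := denomV_norm th cok b1 mus; have d2 := denomV_norm th cok b2 mus.
have := box_denom_gt0 th cok b1 mus; have := box_denom_gt0 th cok b2 mus.
rewrite /rate_defect -mulrBr.
move: lip p1 p2 d1 d2.
have : polar_denom mu th m2 rho2 - polar_denom mu th m1 rho1 =
   mu * sin th * (cubic (m1 - rho1 * cos th) - cubic (m2 - rho2 * cos th))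
   - (rho1 - rho2) by rewrite /polar_denom; ring.
set D1 := polar_denom _ _ m1 _; set D2 := polar_denom _ _ m2 _.
set P1 := cubic _; set P2 := cubic _; set d := `|_| + _ => eD lip p1 p2 v1 v2 D20 D10.
have d0 : 0 <= d by rewrite addr_ge0.
have rd : `|rho1 - rho2| <= d by rewrite lerDr.
have /andP[mu0 mu1] := mus.
have DD : `|D2 - D1| <= 28 * d.
  rewrite eD (_ : 28 * d = 1 * 1 * (27 * d) + d); last by ring.
  rewrite normB_le// !normM_le// ?sin_max// gtr0_norm//.
  by rewrite (le_trans mu1)//; lra.
have -> : P1 ^+ 2 / D1 - P2 ^+ 2 / D2 =
  (P1 - P2) * (P1 + P2) * D1^-1 + P2 * P2 * (D2 - D1) * D1^-1 * D2^-1.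
  by field; rewrite !gt_eqF.
apply: (@le_trans _ _ (1 * (27 * d * (68 + 68) * 3 + 68 * 68 * (28 * d) * 3 * 3))).
  by rewrite normM_le ?sin_max// normD_le// !normM_le// normD_le.
by lra.
Qed.

(** Linearization at the center with a small relative error: 48 [box_radius] = 0.012 and the defect
    contributes at most 10^-5, within 1/80 = 0.0125. Both the contraction and the Lyapunov estimate
    rest on this bound. *)
Lemma polar_rateB c mu th m1 rho1 m2 rho2 :
  center_ok c -> in_box c m1 rho1 -> in_box c m2 rho2 -> mu_small mu ->
  `|polar_rate mu th m1 rho1 - polar_rate mu th m2 rho2
     - slope c th * ((m1 - m2) - cos th * (rho1 - rho2))|
    <= 1 / 80 * (`|m1 - m2| + `|rho1 - rho2|).
Proof.
move=> cok b1 b2 mus; rewrite (polar_rateE th cok b1 mus) (polar_rateE th cok b2 mus).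
have h1 := cubicB th cok b1 b2; have h2 := rate_defectB th cok b1 b2 mus.
move: h1 h2; set d := `|_| + _; set G1 := rate_defect _ _ _ _.
set G2 := rate_defect _ _ _ _ => h1 h2.
rewrite (_ : _ - _ = (cubic (m1 - rho1 * cos th) - cubic (m2 - rho2 * cos th)
     - slope c th * ((m1 - m2) - cos th * (rho1 - rho2))) + mu * (G1 - G2)); last by ring.
have /andP[mu0 mu1] := mus.
have d0 : 0 <= d by rewrite addr_ge0.
have h3 : `|mu * (G1 - G2)| <= 1 / 10 ^+ 12 * (10 ^+ 7 * d).
  by rewrite normM_le// gtr0_norm.
by apply: (le_trans (normD_le h1 h3)); rewrite /box_radius; lra.
Qed.

Lemma polar_rate_lip c mu th m1 rho1 m2 rho2 :
  center_ok c -> in_box c m1 rho1 -> in_box c m2 rho2 -> mu_small mu ->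
  `|polar_rate mu th m1 rho1 - polar_rate mu th m2 rho2|
    <= 27 * (`|m1 - m2| + `|rho1 - rho2|).
Proof.
move=> cok b1 b2 mus; have := polar_rateB th cok b1 b2 mus.
set D := _ - polar_rate _ _ _ _; set l := (m1 - m2) - _ => h.
have := normM_le (slope_norm th cok) (cos_combination_norm th (m1 - m2) (rho1 - rho2)).
rewrite -/l => h2.
rewrite (_ : D = (D - slope c th * l) + slope c th * l); last by ring.
rewrite (le_trans (normD_le h h2))// -mulrDl ler_wpM2r ?addr_ge0//.
by lra.
Qed.

Lemma polar_rate_norm c mu th m rho :
  center_ok c -> in_box c m rho -> mu_small mu -> `|polar_rate mu th m rho| <= 70.
Proof.
move=> cok b mus; rewrite (polar_rateE th cok b mus).
have /andP[mu0 mu1] := mus.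
apply: (@le_trans _ _ (68 + 1 / 10 ^+ 12 * (15 * 10 ^+ 3))); last by lra.
rewrite normD_le ?(box_cubic _ cok)// normM_le// ?(rate_defect_norm _ cok)//.
by rewrite gtr0_norm.
Qed.

Lemma polar_rate_periodic mu (m rho : R -> R) :
  periodic m (turn R) -> periodic rho (turn R) ->
  periodic (fun th => polar_rate mu th (m th) (rho th)) (turn R).
Proof.
move=> mT rT th; rewrite mT rT /polar_rate /polar_denom.
by rewrite cosD2pi sinD2pi.
Qed.

Lemma continuous_cubic_position (a m rho : R -> R) :
  continuous a -> continuous m -> continuous rho ->
  continuous (fun s => cubic (m s - rho s * cos (a s))).
Proof.
move=> ca cm cr; apply/continuous_cubicfun/continuous_subfun => //.
by apply: continuous_mulfun => //; exact: continuous_cosfun.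
Qed.

Lemma continuous_polar_denom mu (a m rho : R -> R) :
  continuous a -> continuous m -> continuous rho ->
  continuous (fun s => polar_denom mu (a s) (m s) (rho s)).
Proof.
move=> ca cm cr; apply: continuous_subfun => //.
apply: continuous_mulfun; last exact: continuous_cubic_position.
apply: continuous_mulfun; first exact: continuous_cstfun.
exact: continuous_sinfun.
Qed.

Lemma polar_rate_continuous c mu (a m rho : R -> R) :
  center_ok c -> mu_small mu -> (forall s, in_box c (m s) (rho s)) ->
  continuous a -> continuous m -> continuous rho ->
  continuous (fun s => polar_rate mu (a s) (m s) (rho s)).
Proof.
move=> cok mus b ca cm cr; apply: continuous_mulfun.
  by apply: continuous_mulfun => //; exact: continuous_cubic_position.
apply: continuous_invfun; last exact: continuous_polar_denom.
by move=> s; rewrite gt_eqF// (box_denom_gt0 _ cok).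
Qed.

End PolarField.

(** * Existence of periodic solutions *)

Section GeometricLimits.
Variable R : realType.

Lemma le0_geometric (C x : R) : (forall n : nat, x <= C / 2 ^+ n) -> x <= 0.
Proof.
move=> xC; rewrite leNgt; apply/negP => x0.
have C0 : 0 < C by rewrite (lt_le_trans x0)// (le_trans (xC 0)) ?expr0 ?divr1.
have := xC (Num.truncn (C / x)).
rewrite ler_pdivlMr ?exprn_gt0//; apply/negP; rewrite -ltNge.
rewrite mulrC -ltr_pdivrMr// (lt_le_trans (truncnS_gt _))//.
by rewrite -natrX ler_nat ltn_expl.
Qed.

Lemma eq_geometric (C x y : R) : (forall n : nat, `|x - y| <= C / 2 ^+ n) -> x = y.
Proof.
by move=> /le0_geometric; rewrite normr_le0 subr_eq0 => /eqP.
Qed.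

(** The intervals of radius C / 2^n around u n meet pairwise, so the supremum of their left ends
    lies in all of them; the rate of convergence comes with the limit. *)
Lemma geometric_limit (C : R) (u : nat -> R) :
  (forall n k, `|u n - u (n + k)%N| <= C / 2 ^+ n) ->
  exists l, forall n, `|u n - l| <= C / 2 ^+ n.
Proof.
move=> uC; have C0 : 0 <= C.
  by have := uC 0%N 0%N; rewrite expr0 divr1; exact: le_trans.
have cross n k : u n - C / 2 ^+ n <= u k + C / 2 ^+ k.
  have g (j : nat) : 0 <= C / 2 ^+ j by rewrite divr_ge0// exprn_ge0.
  have := g n; have := g k.
  have [nk|/ltnW kn] := leqP n k.
    by have := uC n (k - n)%N; rewrite subnKC// ler_norml => /andP[? ?] ? ?; lra.
  by have := uC k (n - k)%N; rewrite subnKC// ler_norml => /andP[? ?] ? ?; lra.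
pose A := [set u n - C / 2 ^+ n | n in [set: nat]].
have A0 : A !=set0 by exists (u 0%N - C / 2 ^+ 0); exists 0%N.
exists (sup A) => n.
have h1 : sup A <= u n + C / 2 ^+ n.
  by apply: ge_sup => // _ [k _ <-].
have h2 : u n - C / 2 ^+ n <= sup A.
  apply: ub_le_sup; last by exists n.
  by exists (u 0%N + C / 2 ^+ 0) => _ [k _ <-].
by rewrite ler_norml; apply/andP; split; lra.
Qed.

Lemma uniform_limit_continuous (C : R) (u : nat -> R -> R) (f : R -> R) :
  (forall n x, `|u n x - f x| <= C / 2 ^+ n) -> (forall n, continuous (u n)) ->
  continuous f.
Proof.
move=> uf cu x; apply/cvgrPdist_le => /= e e0.
have [n nP] : exists n : nat, C / 2 ^+ n <= e / 3.
  apply: contrapT => /forallNP h.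
  have : e / 3 <= 0.
    by apply: (@le0_geometric C) => n; apply/ltW; rewrite ltNge; exact/negP/h.
  by lra.
have e3 : 0 < e / 3 by lra.
have /cvgrPdist_le/(_ _ e3) : u n y @[y --> x] --> u n x := cu n x.
apply: filterS => y h.
rewrite (_ : _ - _ = (f x - u n x) + (u n x - u n y) + (u n y - f y)); last by ring.
have h1 := le_trans (uf n x) nP; have h2 := le_trans (uf n y) nP.
rewrite distrC in h1.
by rewrite (le_trans (normD_le (normD_le h1 h) h2))//; lra.
Qed.

End GeometricLimits.

Section PeriodicSolution.
Variable R : realType.

(** The rate at mu = 0, frozen at the center. Its averages without and with the weight cos th are,
    up to sign, the partial derivatives of [Psi]. *)
Definition mean_field (c : R * R) (th : R) : R := cubic (c.1 - c.2 * cos th).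

(* The averaged equations are the gradient flow of the average over th of the
   primitive of [cubic] at m - rho cos th; its Hessian at c has the entries
   [hess11], [hess12], [hess22]. *)
Definition hess11 (c : R * R) : R := avg (slope c).
Definition hess12 (c : R * R) : R := avg (fun th => - (cos th * slope c th)).
Definition hess22 (c : R * R) : R := avg (fun th => cos th * (cos th * slope c th)).

(* [t.1], [t'], [t.2] are the entries of the inverse of the averaged Hessian. *)
Record simple_zero (c t : R * R) (t' : R) : Prop := SimpleZero {
  nd_center : center_ok c;
  nd_mean : avg (mean_field c) = 0;
  nd_mean_cos : avg (fun th => cos th * mean_field c th) = 0;
  nd_bound : [/\ `|t.1| <= 2, `|t.2| <= 2 & `|t'| <= 2];
  nd_inv1 : t.1 * hess11 c + t' * hess12 c = 1;
  nd_inv2 : t.1 * hess12 c + t' * hess22 c = 0;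
  nd_inv3 : t' * hess11 c + t.2 * hess12 c = 0;
  nd_inv4 : t' * hess12 c + t.2 * hess22 c = 1 }.

Let continuous_center c : continuous (fun th : R => c.1 - c.2 * cos th).
Proof.
apply: continuous_subfun; first exact: continuous_cstfun.
by apply: continuous_mulfun; [exact: continuous_cstfun|exact: continuous_cos].
Qed.

Lemma slope_continuous c : continuous (@slope R c).
Proof.
apply: continuous_subfun; last exact: continuous_cstfun.
apply: continuous_mulfun; first exact: continuous_cstfun.
exact: continuous_sqrfun.
Qed.

Lemma mean_field_continuous c : continuous (mean_field c).
Proof. exact: continuous_cubicfun. Qed.

Variables (mu : R) (c t : R * R) (t' : R).
Hypotheses (mus : mu_small mu) (nd : simple_zero c t t').

Let cok : center_ok c := nd_center nd.

Definition fpair : Type := ((R -> R) * (R -> R))%type.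
Implicit Types v w : fpair.

Definition periodic_pair v : Prop :=
  [/\ continuous v.1, continuous v.2, periodic v.1 (turn R), periodic v.2 (turn R) &
      forall th, in_box c (v.1 th) (v.2 th)].

Definition rate v th : R := polar_rate mu th (v.1 th) (v.2 th).
Definition rate_cos v th : R := cos th * rate v th.

(* A fixed point is a periodic solution: at angle 0 the parentheses must vanish,
   so that both averages are 0 because the Hessian is invertible. *)
Definition picard v : fpair :=
  (fun th => v.1 0 + (t.1 * - avg (rate v) + t' * avg (rate_cos v))
     - mu * hat (rate v) th,
   fun th => v.2 0 + (t' * - avg (rate v) + t.2 * avg (rate_cos v))
     + mu * hat (rate_cos v) th).

(* The oscillation of [picard v] is of order [mu], hence the much smaller weight
   given to the oscillating part. *)
Definition close v w (d : R) : Prop :=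
  `|v.1 0 - w.1 0| + `|v.2 0 - w.2 0| <= d /\
  forall th, `|(v.1 th - w.1 th) - (v.1 0 - w.1 0)|
           + `|(v.2 th - w.2 th) - (v.2 0 - w.2 0)| <= d / 10 ^+ 3.

Lemma close_norm v w d th : close v w d ->
  `|v.1 th - w.1 th| + `|v.2 th - w.2 th| <= (1 + 1 / 10 ^+ 3) * d.
Proof.
move=> [h0 /(_ th) h].
have tri (a b : R) : `|a| <= `|a - b| + `|b|.
  by rewrite -[X in `|X| <= _](subrK b) ler_normD.
have := tri (v.1 th - w.1 th) (v.1 0 - w.1 0).
have := tri (v.2 th - w.2 th) (v.2 0 - w.2 0).
by move=> *; lra.
Qed.

Lemma close_trans u v w d e : close u v d -> close v w e -> close u w (d + e).
Proof.
have tri (a b x : R) : a + b = x -> `|x| <= `|a| + `|b|.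
  by move=> <-; exact: ler_normD.
move=> [h1 k1] [h2 k2]; split=> [|th].
  have := tri (u.1 0 - v.1 0) (v.1 0 - w.1 0) (u.1 0 - w.1 0).
  have := tri (u.2 0 - v.2 0) (v.2 0 - w.2 0) (u.2 0 - w.2 0).
  by move=> /(_ ltac:(ring)) ? /(_ ltac:(ring)) ?; lra.
have := k1 th; have := k2 th.
set a1 := (u.1 th - v.1 th) - _; set a2 := (u.2 th - v.2 th) - _.
set b1 := (v.1 th - w.1 th) - _; set b2 := (v.2 th - w.2 th) - _.
set x1 := (u.1 th - w.1 th) - _; set x2 := (u.2 th - w.2 th) - _.
have := tri a1 b1 x1; have := tri a2 b2 x2.
rewrite /a1 /a2 /b1 /b2 /x1 /x2.
by move=> /(_ ltac:(ring)) ? /(_ ltac:(ring)) ? *; lra.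
Qed.

Lemma rate_continuous v : periodic_pair v -> continuous (rate v).
Proof.
move=> [c1 c2 _ _ b]; apply: (@polar_rate_continuous R c mu id) => //.
by move=> x; exact: cvg_id.
Qed.

Lemma rate_cos_continuous v : periodic_pair v -> continuous (rate_cos v).
Proof.
move=> /rate_continuous cr; apply: continuous_mulfun => //.
exact: continuous_cos.
Qed.

Lemma rate_periodic v : periodic_pair v -> periodic (rate v) (turn R).
Proof. by move=> [_ _ p1 p2 _]; exact: polar_rate_periodic. Qed.

Lemma rate_cos_periodic v : periodic_pair v -> periodic (rate_cos v) (turn R).
Proof. by move=> g th; rewrite /rate_cos rate_periodic// cosD2pi. Qed.

Lemma hat_continuous (f : R -> R) : continuous f -> continuous (hat f).
Proof. by move=> cf; exact: is_derive_continuous (is_derive_hat cf). Qed.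

Lemma rate_close v w d th : periodic_pair v -> periodic_pair w -> close v w d ->
  `|rate v th - rate w th| <= 28 * d.
Proof.
move=> [_ _ _ _ b] [_ _ _ _ b'] vw.
have h := polar_rate_lip th cok (b th) (b' th) mus.
rewrite (le_trans h)//; have := close_norm th vw; move=> ?.
have := le_trans (addr_ge0 (normr_ge0 _) (normr_ge0 _)) vw.1 => ?.
by lra.
Qed.

Lemma cosM_norm th (a C : R) : `|a| <= C -> `|cos th * a| <= C.
Proof. by move=> aC; rewrite -[leRHS]mul1r normM_le ?cos_max. Qed.

Lemma picard_periodic_pair v : periodic_pair v ->
  (forall th, in_box c ((picard v).1 th) ((picard v).2 th)) -> periodic_pair (picard v).
Proof.
move=> g b; split => //.
- apply: continuous_addfun; first exact: continuous_cstfun.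
  apply/continuous_oppfun/continuous_mulfun; first exact: continuous_cstfun.
  exact/hat_continuous/rate_continuous.
- apply: continuous_addfun; first exact: continuous_cstfun.
  apply: continuous_mulfun; first exact: continuous_cstfun.
  exact/hat_continuous/rate_cos_continuous.
- move=> th /=; rewrite hat_periodic//; first exact: rate_continuous.
  exact: rate_periodic.
- move=> th /=; rewrite hat_periodic//; first exact: rate_cos_continuous.
  exact: rate_cos_periodic.
Qed.

(* The defect [rate v - rate w - slope * (dm - cos * drho)], with the increments
   frozen at angle 0, has averages e1, e2; multiplying by the inverse of the
   averaged Hessian turns the constant part of the increment into (e1, e2). *)
Lemma picard_contract v w d : periodic_pair v -> periodic_pair w -> close v w d ->
  close (picard v) (picard w) (d / 2).
Proof.
move=> gv gw vw.
have d0 : 0 <= d := le_trans (addr_ge0 (normr_ge0 _) (normr_ge0 _)) vw.1.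
have cv := rate_continuous gv; have cw := rate_continuous gw.
have ccv := rate_cos_continuous gv; have ccw := rate_cos_continuous gw.
have [mu0 mu1] := andP mus.
split=> [/=|th]; last first.
  rewrite /= !hat0//.
  set a := (X in `|X| + _); set b := (X in _ + `|X|).
  have -> : a = - (mu * hat (rate v \- rate w) th).
    by rewrite /a hatB//; ring.
  have -> : b = mu * hat (rate_cos v \- rate_cos w) th.
    by rewrite /b hatB//; ring.
  have h1 : `|hat (rate v \- rate w) th| <= 16 * (28 * d).
    apply: hat_norm => [x|x|x]; last exact: rate_close.
    - by apply: cvgB; [exact: cv|exact: cw].
    - by rewrite /= !rate_periodic.
  have h2 : `|hat (rate_cos v \- rate_cos w) th| <= 16 * (28 * d).
    apply: hat_norm => [x|x|x].
    - by apply: cvgB; [exact: ccv|exact: ccw].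
    - by rewrite /= !rate_cos_periodic.
    - by rewrite /= /rate_cos -mulrBr cosM_norm// rate_close.
  have m1 : `|mu| <= 1 / 10 ^+ 12 by rewrite gtr0_norm.
  have := normM_le m1 h1; have := normM_le m1 h2; rewrite normrN.
  by move=> *; lra.
rewrite !hat0// !mulr0 !subr0 !addr0.
set a0 := v.1 0 - w.1 0; set b0 := v.2 0 - w.2 0.
pose f th := slope c th * (a0 - cos th * b0) - (rate v th - rate w th).
have cs := @slope_continuous c.
have ccos : continuous (fun th : R => cos th) := @continuous_cos R.
have cls : continuous (fun th => - (cos th * slope c th)).
  exact/continuous_oppfun/continuous_mulfun.
have clls : continuous (fun th => cos th * (cos th * slope c th)).
  by apply: continuous_mulfun => //; exact: continuous_mulfun.
have cf : continuous f.
  apply: continuous_subfun; last exact: continuous_subfun.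
  apply: continuous_mulfun => //.
  apply: continuous_subfun; first exact: continuous_cstfun.
  by apply: continuous_mulfun => //; exact: continuous_cstfun.
(* The nonlinear remainder gives 1.001 / 80, and freezing the increment at angle 0 gives 26 / 10^3,
   in total less than 0.04. The inverse Hessian, with entries at most 2, then yields 0.16 d per
   component, so 0.32 d <= d / 2 in all. *)
have fn th : `|f th| <= 4 / 100 * d.
  have [_ _ _ _ bv] := gv; have [_ _ _ _ bw] := gw.
  have h := polar_rateB th cok (bv th) (bw th) mus.
  have hn := close_norm th vw.
  have [_ /(_ th)] := vw; rewrite -/a0 -/b0 => ho.
  have hs := normM_le (slope_norm th cok) (le_trans (cos_combination_norm th _ _) ho).
  move: h hs; rewrite -/(rate v th) -/(rate w th).
  set l := (v.1 th - w.1 th) - cos th * _ => h hs.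
  rewrite (_ : f th = - (rate v th - rate w th - slope c th * l)
     - slope c th * ((v.1 th - w.1 th - a0) - cos th * (v.2 th - w.2 th - b0))); last first.
    by rewrite /f /l; ring.
  rewrite -normrN in h.
  by rewrite (le_trans (normB_le h hs))//; lra.
pose e1 := avg f; pose e2 := avg (fun th => - (cos th * f th)).
have e1n : `|e1| <= 4 / 100 * d by exact: avg_norm.
have e2n : `|e2| <= 4 / 100 * d.
  apply: avg_norm => [|th]; first exact/continuous_oppfun/continuous_mulfun.
  by rewrite normrN cosM_norm.
have e1E : e1 = hess11 c * a0 + hess12 c * b0 - (avg (rate v) - avg (rate w)).
  rewrite /hess11 /hess12 (mulrC _ a0) (mulrC _ b0) -!avgZ// -avgB// -avgD//; last 2 first.
  - by apply: continuous_mulfun => //; exact: continuous_cstfun.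
  - by apply: continuous_mulfun => //; exact: continuous_cstfun.
  rewrite -avgB; last 2 first.
  - by apply: continuous_addfun; apply: continuous_mulfun => //; exact: continuous_cstfun.
  - by apply: continuous_addfun => //; exact: continuous_oppfun.
  by congr avg; apply/funext => th /=; rewrite /f; ring.
have e2E : e2 = hess12 c * a0 + hess22 c * b0 + (avg (rate_cos v) - avg (rate_cos w)).
  rewrite /hess22 /hess12 (mulrC _ a0) (mulrC _ b0) -!avgZ// -avgB// -avgD//; last 2 first.
  - by apply: continuous_mulfun => //; exact: continuous_cstfun.
  - by apply: continuous_mulfun => //; exact: continuous_cstfun.
  rewrite -avgD; last 2 first.
  - by apply: continuous_addfun; apply: continuous_mulfun => //; exact: continuous_cstfun.
  - by apply: continuous_addfun => //; exact: continuous_oppfun.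
  by congr avg; apply/funext => th /=; rewrite /f /rate_cos; ring.
have [t1n t2n t'n] := nd_bound nd.
set x := (X in `|X| + _); set y := (X in _ + `|X|).
have -> : x = t.1 * e1 + t' * e2.
  rewrite e1E e2E /x.
  transitivity (1 * a0 + 0 * b0 - t.1 * (avg (rate v) - avg (rate w))
    + t' * (avg (rate_cos v) - avg (rate_cos w))).
    by rewrite /a0; ring.
  by rewrite -(nd_inv1 nd) -(nd_inv2 nd); ring.
have -> : y = t' * e1 + t.2 * e2.
  rewrite e1E e2E /y.
  transitivity (0 * a0 + 1 * b0 - t' * (avg (rate v) - avg (rate w))
    + t.2 * (avg (rate_cos v) - avg (rate_cos w))).
    by rewrite /b0; ring.
  by rewrite -(nd_inv3 nd) -(nd_inv4 nd); ring.
have := normD_le (normM_le t1n e1n) (normM_le t'n e2n).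
have := normD_le (normM_le t'n e1n) (normM_le t2n e2n).
by move=> *; lra.
Qed.

Definition start : fpair := (fun=> c.1, fun=> c.2).

Lemma start_periodic_pair : periodic_pair start.
Proof.
by split=> //= *; [exact: continuous_cstfun|exact: continuous_cstfun|exact: in_box_center].
Qed.

(** The averages of [mean_field] vanish at the critical point, so the Newton correction only sees mu
    times the defect, at most 1.5 10^-8; the oscillating part is of order mu as well. *)
Lemma picard_start : close start (picard start) (1 / 10 ^+ 5).
Proof.
have g := start_periodic_pair.
have cr := rate_continuous g; have crc := rate_cos_continuous g.
have [mu0 mu1] := andP mus.
have m1 : `|mu| <= 1 / 10 ^+ 12 by rewrite gtr0_norm.
have cm := @mean_field_continuous c.
have ccm : continuous (fun th => cos th * mean_field c th).
  by apply: continuous_mulfun => //; exact: continuous_cos.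
have dn th : `|rate start th - mean_field c th| <= 1 / 10 ^+ 12 * (15 * 10 ^+ 3).
  rewrite /rate (polar_rateE th cok (in_box_center c) mus) addrAC subrr add0r.
  by rewrite normM_le// (rate_defect_norm th cok (in_box_center c)).
have a1 : `|avg (rate start)| <= 1 / 10 ^+ 12 * (15 * 10 ^+ 3).
  rewrite -[avg _]subr0 -(nd_mean nd) -avgB//; apply: avg_norm => // x.
  by apply: cvgB; [exact: cr|exact: cm].
have a2 : `|avg (rate_cos start)| <= 1 / 10 ^+ 12 * (15 * 10 ^+ 3).
  rewrite -[avg _]subr0 -(nd_mean_cos nd) -avgB//; apply: avg_norm => x /=.
    by apply: cvgB; [exact: crc|exact: ccm].
  by rewrite /rate_cos -mulrBr cosM_norm.
have rn th : `|rate start th| <= 70 by exact: polar_rate_norm cok (in_box_center c) mus.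
have [t1n t2n t'n] := nd_bound nd.
have a1' : `|- avg (rate start)| <= 1 / 10 ^+ 12 * (15 * 10 ^+ 3) by rewrite normrN.
split=> [|th] /=; rewrite !hat0// mulr0.
  have := normD_le (normM_le t1n a1') (normM_le t'n a2).
  have := normD_le (normM_le t'n a1') (normM_le t2n a2).
  set x := t.1 * _ + _; set y := t' * _ + _ => h1 h2.
  have -> : c.1 - (c.1 + x - 0) = - x by ring.
  have -> : c.2 - (c.2 + y + 0) = - y by ring.
  by rewrite !normrN; lra.
set x := (X in `|X| + _); set y := (X in _ + `|X|).
have -> : x = mu * hat (rate start) th by rewrite /x; ring.
have -> : y = - (mu * hat (rate_cos start) th) by rewrite /y; ring.
have h1 := hat_norm cr (rate_periodic g) rn th.
have h2 := hat_norm crc (rate_cos_periodic g) (fun th => cosM_norm th (rn th)) th.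
have := normM_le m1 h1; have := normM_le m1 h2; rewrite normrN.
by move=> *; lra.
Qed.

Definition iterates n : fpair := iter n picard start.

Lemma close_start_in_box v th :
  close start v (2 / 10 ^+ 5) -> in_box c (v.1 th) (v.2 th).
Proof.
move=> /(close_norm th) /= h.
have h1 := normr_ge0 (c.1 - v.1 th); have h2 := normr_ge0 (c.2 - v.2 th).
by split; rewrite distrC /box_radius; lra.
Qed.

(** The three claims need one another: the contraction applies only inside the box, and the iterates
    remain there because the geometric series of steps sums to at most 2 10^-5, well below
    [box_radius]. *)
Lemma iterates_spec n : [/\ periodic_pair (iterates n),
  close start (iterates n) (2 / 10 ^+ 5 * (1 - 1 / 2 ^+ n)) &
  close (iterates n) (iterates n.+1) (1 / 10 ^+ 5 / 2 ^+ n)].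
Proof.
elim: n => [|n [g s h]].
  rewrite expr0 !divr1 subrr mulr0; split; [exact: start_periodic_pair| |exact: picard_start].
  by split=> [|th]; rewrite /iterates/= !subrr !normr0 ?addr0 ?mul0r.
have p2 : 0 < (2 : R) ^+ n by rewrite exprn_gt0.
have s' : close start (iterates n.+1) (2 / 10 ^+ 5 * (1 - 1 / 2 ^+ n.+1)).
  have := close_trans s h.
  rewrite (_ : _ + _ = 2 / 10 ^+ 5 * (1 - 1 / 2 ^+ n.+1))// [2 ^+ n.+1]exprS.
  by field; rewrite gt_eqF.
have g' : periodic_pair (iterates n.+1).
  apply: picard_periodic_pair => // th; apply: close_start_in_box.
  have weaken d e v w : d <= e -> close v w d -> close v w e.
    move=> de [h1 h2]; split=> [|x]; first exact: le_trans de.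
    by rewrite (le_trans (h2 x))// ler_wpM2r.
  have q : 0 < (2 ^+ n.+1)^-1 :> R by rewrite invr_gt0 exprn_gt0.
  by apply: weaken s'; lra.
split => //.
have := picard_contract g g' h.
rewrite (_ : 1 / 10 ^+ 5 / 2 ^+ n / 2 = 1 / 10 ^+ 5 / 2 ^+ n.+1)// [2 ^+ n.+1]exprS.
by field; rewrite gt_eqF.
Qed.

Lemma iterates_close n k :
  close (iterates n) (iterates (n + k)) (2 / 10 ^+ 5 / 2 ^+ n * (1 - 1 / 2 ^+ k)).
Proof.
elim: k => [|k h].
  rewrite addn0 expr0 divr1 subrr mulr0.
  by split=> [|th]; rewrite !subrr ?normr0 ?addr0 ?mul0r.
have [_ _ h'] := iterates_spec (n + k); rewrite addnS.
have := close_trans h h'.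
rewrite (_ : _ + _ = 2 / 10 ^+ 5 / 2 ^+ n * (1 - 1 / 2 ^+ k.+1))// [2 ^+ k.+1]exprS exprD.
by field; rewrite !gt_eqF ?exprn_gt0.
Qed.

Lemma iterates_dist n k th :
  `|(iterates n).1 th - (iterates (n + k)).1 th| <= 3 / 10 ^+ 5 / 2 ^+ n /\
  `|(iterates n).2 th - (iterates (n + k)).2 th| <= 3 / 10 ^+ 5 / 2 ^+ n.
Proof.
have := close_norm th (iterates_close n k).
set a := `|_|; set b := `|_|; set x := _ * (_ * _) => ab.
suff xl : x <= 3 / 10 ^+ 5 / 2 ^+ n.
  by split; rewrite (le_trans _ (le_trans ab xl))// ?lerDl ?lerDr// normr_ge0.
rewrite /x; have p : 0 < (2 ^+ n)^-1 :> R by rewrite invr_gt0 exprn_gt0.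
have q : 0 < (2 ^+ k)^-1 :> R by rewrite invr_gt0 exprn_gt0.
by nra.
Qed.

Theorem periodic_solution : exists m rho : R -> R,
  [/\ periodic m (turn R), periodic rho (turn R),
      forall th, `|m th - c.1| < box_radius R /\ `|rho th - c.2| < box_radius R,
      forall th : R, is_derive th 1 m (- (mu * polar_rate mu th (m th) (rho th))) &
      forall th : R, is_derive th 1 rho (mu * (cos th * polar_rate mu th (m th) (rho th)))].
Proof.
have /choice[m mP] : forall th, exists l, forall n,
    `|(iterates n).1 th - l| <= 3 / 10 ^+ 5 / 2 ^+ n.
  by move=> th; apply: geometric_limit => n k; case: (iterates_dist n k th).
have /choice[rho rP] : forall th, exists l, forall n,
    `|(iterates n).2 th - l| <= 3 / 10 ^+ 5 / 2 ^+ n.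
  by move=> th; apply: geometric_limit => n k; case: (iterates_dist n k th).
have it n := iterates_spec n.
have lim_periodic (i : nat -> R -> R) (f : R -> R) : (forall n, periodic (i n) (turn R)) ->
    (forall th n, `|i n th - f th| <= 3 / 10 ^+ 5 / 2 ^+ n) -> periodic f (turn R).
  move=> pi iP th; apply: (@eq_geometric _ (6 / 10 ^+ 5)) => n.
  have := iP (th + turn R) n; rewrite pi distrC => h1; have := iP th n => h2.
  rewrite (_ : _ - _ = (f (th + turn R) - i n th) + (i n th - f th)); last by ring.
  by rewrite (le_trans (normD_le h1 h2))//; lra.
(* Strictness is wanted because the neighborhood isolating the cycle will be the open box. *)
have strict th : `|m th - c.1| < box_radius R /\ `|rho th - c.2| < box_radius R.
  have := mP th 0%N; have := rP th 0%N.
  rewrite /iterates/= expr0 divr1 distrC => h1; rewrite distrC => h2.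
  by split; rewrite /box_radius ?(le_lt_trans h1) ?(le_lt_trans h2)//; lra.
have g : periodic_pair (m, rho).
  split => /=.
  - apply: (@uniform_limit_continuous _ _ (fun n => (iterates n).1)) => // n.
    by case: (it n) => -[].
  - apply: (@uniform_limit_continuous _ _ (fun n => (iterates n).2)) => // n.
    by case: (it n) => -[].
  - by apply: (lim_periodic (fun n => (iterates n).1)) => // n; case: (it n) => -[].
  - by apply: (lim_periodic (fun n => (iterates n).2)) => // n; case: (it n) => -[].
  - by move=> th; case: (strict th) => h1 h2; split; exact: ltW.
(* The oscillations of the two components sum to at most 4 times 3 / 10^5 (over 2^n), and [close]
   weights oscillations by 10^3. *)
have cl n : close (iterates n) (m, rho) ((12 / 100) / 2 ^+ n).
  have p : 0 < (2 ^+ n)^-1 :> R by rewrite invr_gt0 exprn_gt0.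
  split=> [|th] /=; first by have := mP 0 n; have := rP 0 n => *; nra.
  have := normB_le (mP th n) (mP 0 n); have := normB_le (rP th n) (rP 0 n) => *.
  by nra.
(* Iterate n + 1 is close both to the limit and, by contraction, to the image of the limit. *)
have fix_eq th : m th = (picard (m, rho)).1 th /\ rho th = (picard (m, rho)).2 th.
  have h n : `|(picard (m, rho)).1 th - m th| <= (2 / 10) / 2 ^+ n /\
             `|(picard (m, rho)).2 th - rho th| <= (2 / 10) / 2 ^+ n.
    have [gn _ _] := it n.
    have p : 0 < (2 ^+ n)^-1 :> R by rewrite invr_gt0 exprn_gt0.
    have := close_norm th (picard_contract gn g (cl n)).
    rewrite -/(iterates n.+1); have := mP th n.+1; have := rP th n.+1.
    rewrite [2 ^+ n.+1]exprS invfM.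
    set i1 := (iterates n.+1).1 th; set i2 := (iterates n.+1).2 th.
    set p1 := (picard _).1 th; set p2 := (picard _).2 th => h1 h2 h3.
    have q1 : `|i1 - p1| <= (1 + 1 / 10 ^+ 3) * ((12 / 100) / 2 ^+ n / 2).
      by rewrite (le_trans _ h3)// lerDl.
    have q2 : `|i2 - p2| <= (1 + 1 / 10 ^+ 3) * ((12 / 100) / 2 ^+ n / 2).
      by rewrite (le_trans _ h3)// lerDr.
    rewrite distrC in q1; rewrite distrC in q2; split.
      rewrite (_ : _ - _ = (p1 - i1) + (i1 - m th)); last by ring.
      by rewrite (le_trans (normD_le q1 h2))//; nra.
    rewrite (_ : _ - _ = (p2 - i2) + (i2 - rho th)); last by ring.
    by rewrite (le_trans (normD_le q2 h1))//; nra.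
  by split; apply/esym/eq_geometric => n; case: (h n) => h1 h2; [exact: h1|exact: h2].
pose q := rate (m, rho); pose qc := rate_cos (m, rho).
have cq : continuous q := rate_continuous g.
have cqc : continuous qc := rate_cos_continuous g.
have [E1 E2] := fix_eq 0; move: E1 E2; rewrite /= !hat0// !mulr0 subr0 addr0 -/q -/qc.
move=> /eqP; rewrite -[X in X == _]addr0 => /eqP/addrI E1.
move=> /eqP; rewrite -[X in X == _]addr0 => /eqP/addrI E2.
(* [E1] and [E2] say that the inverse Hessian sends (- avg q, avg qc) to 0; applying the Hessian
   recovers both averages. *)
have aq : avg q = 0.
  rewrite -[LHS]opprK -[- avg q]mul1r -(nd_inv1 nd).
  have e3 := nd_inv3 nd.
  transitivity (- (hess11 c * (t.1 * - avg q + t' * avg qc)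
     + hess12 c * (t' * - avg q + t.2 * avg qc)
     - (t' * hess11 c + t.2 * hess12 c) * avg qc)); first by ring.
  by rewrite -E1 -E2 e3; ring.
have aqc : avg qc = 0.
  rewrite -[LHS]mul1r -(nd_inv4 nd).
  have e3 := nd_inv2 nd.
  transitivity (hess12 c * (t.1 * - avg q + t' * avg qc)
     + hess22 c * (t' * - avg q + t.2 * avg qc)
     + (t.1 * hess12 c + t' * hess22 c) * avg q); first by ring.
  by rewrite -E1 -E2 e3; ring.
have mE : m = fun th => m 0 - mu * hat q th.
  by apply/funext => th; rewrite {1}(fix_eq th).1 /= -/q -/qc -E1 addr0.
have rE : rho = fun th => rho 0 + mu * hat qc th.
  by apply/funext => th; rewrite {1}(fix_eq th).2 /= -/q -/qc -E2 addr0.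
have [_ _ pm pr _] := g.
exists m, rho; split => // th.
  have := is_derive_hat cq th; rewrite aq subr0 => ?.
  have : is_derive th 1 (fun th => m 0 - mu * hat q th) (- (mu * q th)).
    by apply: is_derive_eq; rewrite /GRing.scale/=; ring.
  by rewrite -mE.
have := is_derive_hat cqc th; rewrite aqc subr0 => ?.
have : is_derive th 1 (fun th => rho 0 + mu * hat qc th) (mu * qc th).
  by apply: is_derive_eq; rewrite /GRing.scale/=; ring.
by rewrite -rE.
Qed.

End PeriodicSolution.

(** * Isolation *)

Section BoundedLyapunov.
Variable R : realType.

(** V is nonincreasing, so after a negative value V s its slope stays below k V s; within a time L
    proportional to 2 B + 1 it would fall by more than the bound allows. *)
Lemma bounded_lyapunov_ge0 (V dV : R -> R) (B k : R) : 0 < k ->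
  (forall s : R, is_derive s 1 V (dV s)) ->
  (forall s, dV s <= - k * `|V s|) -> (forall s, `|V s| <= B) ->
  forall s, 0 <= V s.
Proof.
move=> k0 VdV dVk VB s; rewrite leNgt; apply/negP => V0.
have B0 : 0 <= B := le_trans (normr_ge0 _) (VB 0).
have kV : 0 < k * - V s by rewrite mulr_gt0 ?oppr_gt0.
pose L := (2 * B + 1) / (k * - V s).
have L0 : 0 < L by rewrite divr_gt0//; lra.
have [c /andP[sc _] e] : exists2 c, s <= c <= s + L & V (s + L) - V s = dV c * (s + L - s).
  by apply: mean_value VdV; rewrite lerDl ltW.
have Vc : V c <= V s.
  have [d _ e'] := mean_value sc VdV.
  have dVd : dV d <= 0 by rewrite (le_trans (dVk d))// mulNr oppr_le0 mulr_ge0// ltW.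
  by rewrite -subr_le0 e' mulr_le0_ge0// subr_ge0.
have h1 := dVk c.
have := VB (s + L); have := VB s; rewrite !ler_norml => /andP[u1 u2] /andP[w1 w2].
have Vc0 : V c <= 0 by lra.
rewrite (ler0_norm Vc0) in h1.
have LE : L * (k * - V s) = 2 * B + 1 by rewrite divfK// gt_eqF.
rewrite addrAC subrr add0r in e.
have dVc : dV c <= k * V s by rewrite (le_trans h1)// mulrNN ler_wpM2l// ltW.
have : dV c * L <= - (L * (k * - V s)).
  by rewrite !mulrN opprK (mulrC L) ler_wpM2r// ltW.
by rewrite -e LE => h; lra.
Qed.

(* A strict Lyapunov function vanishes along any complete bounded orbit: it
   would otherwise diverge in forward or in backward time. *)
Lemma bounded_lyapunov_eq0 (V dV : R -> R) (B k : R) : 0 < k ->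
  (forall s : R, is_derive s 1 V (dV s)) ->
  (forall s, dV s <= - k * `|V s|) -> (forall s, `|V s| <= B) ->
  forall s, V s = 0.
Proof.
move=> k0 VdV dVk VB s; apply/eqP; rewrite eq_le; apply/andP; split; last first.
  exact: bounded_lyapunov_ge0 VdV dVk VB s.
rewrite -oppr_ge0 -[s in V s]opprK.
apply: (@bounded_lyapunov_ge0 (fun x => - V (- x)) (fun x => dV (- x)) B k k0).
- move=> x; have := VdV (- x) => h.
  have h' : is_derive x 1 (V \o -%R) (dV (- x) * -1).
    by apply: is_derive1_comp.
  by apply: is_derive_eq; ring.
- by move=> x; rewrite normrN.
- by move=> x; rewrite normrN.
Qed.

End BoundedLyapunov.

Section Isolation.
Variable R : realType.
Variables (mu : R) (c t : R * R) (t' : R).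
Hypotheses (mus : mu_small mu) (nd : simple_zero c t t').
Let cok : center_ok c := nd_center nd.

Variables (M P : R -> R).
Hypotheses (MPbox : forall th, in_box c (M th) (P th))
  (dM : forall th : R, is_derive th 1 M (- (mu * polar_rate mu th (M th) (P th))))
  (dP : forall th : R, is_derive th 1 P (mu * (cos th * polar_rate mu th (M th) (P th)))).

Variables (m rho ang speed : R -> R).
Hypotheses (box : forall s, in_box c (m s) (rho s)) (speed_ge : forall s, 1 / 2 <= speed s)
  (dm : forall s : R, is_derive s 1 m
     (- (speed s * (mu * polar_rate mu (ang s) (m s) (rho s)))))
  (drho : forall s : R, is_derive s 1 rho
     (speed s * (mu * (cos (ang s) * polar_rate mu (ang s) (m s) (rho s)))))
  (dang : forall s : R, is_derive s 1 ang (speed s)).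

Let k1 := hat (slope c).
Let k2 := hat (fun th => - (cos th * slope c th)).
Let k3 := hat (fun th => cos th * (cos th * slope c th)).
Let h11 := hess11 c.
Let h12 := hess12 c.
Let h22 := hess22 c.

Let x s := m s - M (ang s).
Let y s := rho s - P (ang s).
Let D s := polar_rate mu (ang s) (m s) (rho s)
  - polar_rate mu (ang s) (M (ang s)) (P (ang s)).
Let u s := h11 * x s + h12 * y s.
Let v s := h12 * x s + h22 * y s.

(** [c11], [c12], [c22] are the coefficients of u (k1 x + k2 y) + v (k2 x + k3 y) as a quadratic
    form in x, y. The derivatives of k1, k2, k3 are the oscillating parts of the entries of the
    unaveraged Hessian. *)
Let c11 s := h11 * k1 (ang s) + h12 * k2 (ang s).
Let c12 s := h12 * k1 (ang s) + h22 * k2 (ang s) + h11 * k2 (ang s) + h12 * k3 (ang s).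
Let c22 s := h12 * k2 (ang s) + h22 * k3 (ang s).

(* Half the averaged Hessian form, plus a correction of order [mu] whose
   derivative replaces the oscillating coefficients by their averages. *)
Let V s := 1 / 2 * (h11 * x s ^+ 2 + 2 * h12 * (x s * y s) + h22 * y s ^+ 2)
  + mu * (c11 s * x s ^+ 2 + c12 s * (x s * y s) + c22 s * y s ^+ 2).

Let err s := D s - slope c (ang s) * (x s - cos (ang s) * y s).
(** [Z * D] comes from differentiating x and y in the correction term, which yields a second factor
    mu. *)
Let Z s := (c12 s * x s + 2 * c22 s * y s) * cos (ang s) - (2 * c11 s * x s + c12 s * y s).
Let dV s := speed s * mu *
  (- (u s ^+ 2 + v s ^+ 2) - (u s - cos (ang s) * v s) * err s + mu * (Z s * D s)).

Let slope_cont := @slope_continuous R c.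
Let ccos : continuous (fun th : R => cos th) := @continuous_cos R.
Let cont2 : continuous (fun th => - (cos th * slope c th)).
Proof. exact/continuous_oppfun/continuous_mulfun. Qed.
Let cont3 : continuous (fun th => cos th * (cos th * slope c th)).
Proof. by apply: continuous_mulfun => //; exact: continuous_mulfun. Qed.

Let slope_turn : periodic (slope c) (turn R).
Proof. by move=> th; rewrite /slope cosD2pi. Qed.

Let is_derive_V (s : R) : is_derive s 1 V (dV s).
Proof.
have d1 : is_derive s 1 (k1 \o ang) ((slope c (ang s) - h11) * speed s).
  by have := is_derive_hat slope_cont (ang s) => ?; apply: is_derive1_comp.
have d2 : is_derive s 1 (k2 \o ang) ((- (cos (ang s) * slope c (ang s)) - h12) * speed s).
  by have := is_derive_hat cont2 (ang s) => ?; apply: is_derive1_comp.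
have d3 : is_derive s 1 (k3 \o ang)
    ((cos (ang s) * (cos (ang s) * slope c (ang s)) - h22) * speed s).
  by have := is_derive_hat cont3 (ang s) => ?; apply: is_derive1_comp.
have dx : is_derive s 1 x (- (speed s * (mu * D s))).
  have e1 : is_derive s 1 (M \o ang)
      (- (mu * polar_rate mu (ang s) (M (ang s)) (P (ang s))) * speed s).
    by apply: is_derive1_comp.
  by apply: is_derive_eq; rewrite /D; ring.
have dy : is_derive s 1 y (speed s * (mu * (cos (ang s) * D s))).
  have e1 : is_derive s 1 (P \o ang)
      (mu * (cos (ang s) * polar_rate mu (ang s) (M (ang s)) (P (ang s))) * speed s).
    by apply: is_derive1_comp.
  by apply: is_derive_eq; rewrite /D; ring.
rewrite /V /c11 /c12 /c22.
pose f1 := k1 \o ang; pose f2 := k2 \o ang; pose f3 := k3 \o ang.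
have e : is_derive s 1 (fun s =>
  1 / 2 * (h11 * x s ^+ 2 + 2 * h12 * (x s * y s) + h22 * y s ^+ 2)
  + mu * ((h11 * f1 s + h12 * f2 s) * x s ^+ 2
   + (h12 * f1 s + h22 * f2 s + h11 * f2 s + h12 * f3 s) * (x s * y s) +
   (h12 * f2 s + h22 * f3 s) * y s ^+ 2)) (dV s).
  apply: is_derive_eq.
  rewrite /GRing.scale/= /dV /Z /c11 /c12 /c22 /u /v /err /f1 /f2 /f3 /=.
  by field.
exact: e.
Qed.

Let hess_norm : [/\ `|h11| <= 26, `|h12| <= 26 & `|h22| <= 26].
Proof.
split; apply: avg_norm => // th; rewrite ?normrN; first exact: slope_norm.
- by rewrite cosM_norm// slope_norm.
- by rewrite !cosM_norm// slope_norm.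
Qed.

Let hat_slope_norm th : [/\ `|k1 th| <= 416, `|k2 th| <= 416 & `|k3 th| <= 416].
Proof.
have -> : 416 = 16 * 26 :> R by ring.
split; apply: hat_norm => // th'; rewrite ?slope_turn ?cosD2pi ?normrN//.
- exact: slope_norm.
- by rewrite cosM_norm// slope_norm.
- by rewrite !cosM_norm// slope_norm.
Qed.

Let corr_norm s : [/\ `|c11 s| <= 3 * 10 ^+ 4,
  `|c12 s| <= 6 * 10 ^+ 4 & `|c22 s| <= 3 * 10 ^+ 4].
Proof.
have [a1 a2 a3] := hess_norm; have [b1 b2 b3] := hat_slope_norm (ang s).
have e (i j : R) : `|i| <= 26 -> `|j| <= 416 -> `|i * j| <= 26 * 416.
  exact: normM_le.
split.
- by rewrite (le_trans (normD_le (e _ _ a1 b1) (e _ _ a2 b2)))//; lra.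
- have h1 := normD_le (e _ _ a2 b1) (e _ _ a3 b2).
  have h2 := normD_le (normD_le h1 (e _ _ a1 b2)) (e _ _ a2 b3).
  by rewrite (le_trans h2)//; lra.
- by rewrite (le_trans (normD_le (e _ _ a2 b2) (e _ _ a3 b3)))//; lra.
Qed.

Let del s := `|x s| + `|y s|.
Let Y s := `|u s| + `|v s|.

Let del_ge0 s : 0 <= del s. Proof. exact: addr_ge0. Qed.

(** Nondegeneracy: (x, y) is recovered from (u, v) by the inverse Hessian, whose entries are at most
    2. *)
Let del_le s : del s <= 4 * Y s.
Proof.
have [t1 t2 t3] := nd_bound nd.
have xE : x s = t.1 * u s + t' * v s.
  transitivity (1 * x s + 0 * y s); first by ring.
  by rewrite -(nd_inv1 nd) -(nd_inv2 nd) /u /v /h11 /h12 /h22; ring.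
have yE : y s = t' * u s + t.2 * v s.
  transitivity (0 * x s + 1 * y s); first by ring.
  by rewrite -(nd_inv3 nd) -(nd_inv4 nd) /u /v /h11 /h12 /h22; ring.
have := normD_le (normM_le t1 (lexx `|u s|)) (normM_le t3 (lexx `|v s|)).
have := normD_le (normM_le t3 (lexx `|u s|)) (normM_le t2 (lexx `|v s|)).
by rewrite -xE -yE /del /Y => *; lra.
Qed.

(** The Hessian form accounts for 13 = 26 / 2, and the correction of order mu for much less than
    1. *)
Let V_norm s : `|V s| <= 14 * del s ^+ 2.
Proof.
have [a1 a2 a3] := hess_norm; have [b1 b2 b3] := corr_norm s.
have /andP[mu0 mu1] := mus.
have m1 : `|mu| <= 1 / 10 ^+ 12 by rewrite gtr0_norm.
have xd : `|x s| <= del s by rewrite lerDl.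
have yd : `|y s| <= del s by rewrite lerDr.
have xx : `|x s ^+ 2| = `|x s| ^+ 2 by rewrite normrX.
have yy : `|y s ^+ 2| = `|y s| ^+ 2 by rewrite normrX.
have xy : `|x s * y s| = `|x s| * `|y s| by rewrite normrM.
have q (a b d A B : R) : `|a| <= A -> `|b| <= B -> `|d| <= A ->
    `|a * x s ^+ 2 + b * (x s * y s) + d * y s ^+ 2| <=
    A * `|x s| ^+ 2 + B * (`|x s| * `|y s|) + A * `|y s| ^+ 2.
  by move=> *; rewrite !normD_le// normM_le// ?xx ?xy ?yy.
have h2 : `|2 * h12| <= 2 * 26 by rewrite normM_le// ger0_norm.
have g1 := q _ _ _ _ _ a1 h2 a3; have g2 := q _ _ _ _ _ b1 b2 b3.
have half : `|1 / 2 : R| <= 1 / 2 by rewrite ger0_norm.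
have := normD_le (normM_le half g1) (normM_le m1 g2); rewrite -/(V s).
have X0 := normr_ge0 (x s); have Y0 := normr_ge0 (y s).
have -> : del s = `|x s| + `|y s| by [].
move: X0 Y0; set X := `|x s|; set W := `|y s| => X0 Y0 h.
apply: (le_trans h).
have XW := mulr_ge0 X0 Y0.
have X2 := sqr_ge0 X; have W2 := sqr_ge0 W.
rewrite (_ : (X + W) ^+ 2 = X ^+ 2 + 2 * (X * W) + W ^+ 2); last by ring.
move: XW X2 W2; set a := X * W; set b := X ^+ 2; set d := W ^+ 2 => XW X2 W2.
by lra.
Qed.

(** The main term is at most - Y^2 / 2, the linearization error costs Y^2 / 20, and Y^2 >= del^2 /
    16; what remains is below - del^2 / 64 even after the term with [Z]. The last factor 1/2 is the
    lower bound of the speed. *)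
Let dV_le s : dV s <= - (mu / 2 ^+ 7) * del s ^+ 2.
Proof.
have /andP[mu0 mu1] := mus.
have [b1 b2 b3] := corr_norm s.
have d0 := del_ge0 s; have dY := del_le s.
have Y0 : 0 <= Y s by rewrite addr_ge0.
have xd : `|x s| <= del s by rewrite lerDl.
have yd : `|y s| <= del s by rewrite lerDr.
have errn : `|err s| <= 1 / 80 * del s :=
  polar_rateB (ang s) cok (box s) (MPbox (ang s)) mus.
have Dn : `|D s| <= 27 * del s :=
  polar_rate_lip (ang s) cok (box s) (MPbox (ang s)) mus.
have n2 (z C : R) : `|z| <= C -> `|2 * z| <= 2 * C.
  by move=> ?; rewrite normM_le// ger0_norm.
have Zn : `|Z s| <= 24 * 10 ^+ 4 * del s.
  have g1 := normD_le (normM_le b2 xd) (normM_le (n2 _ _ b3) yd).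
  have g2 := normD_le (normM_le (n2 _ _ b1) xd) (normM_le b2 yd).
  by rewrite /Z mulrC (le_trans (normB_le (cosM_norm _ g1) g2))//; lra.
have t1 : `|(u s - cos (ang s) * v s) * err s| <= Y s * (1 / 80 * (4 * Y s)).
  rewrite normM_le// ?cos_combination_norm// (le_trans errn)//.
  by rewrite ler_wpM2l//; lra.
have t2 : `|mu * (Z s * D s)| <= 1 / 10 ^+ 12 * (24 * 10 ^+ 4 * del s * (27 * del s)).
  by apply: normM_le; [rewrite gtr0_norm|exact: normM_le].
have t3 : del s ^+ 2 <= 16 * Y s ^+ 2 by nra.
have t4 : Y s ^+ 2 <= 2 * (u s ^+ 2 + v s ^+ 2).
  rewrite /Y -(real_normK (num_real (u s))) -(real_normK (num_real (v s))).
  have := sqr_ge0 (`|u s| - `|v s|); rewrite !expr2 => ?; nra.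
have key : - (u s ^+ 2 + v s ^+ 2) - (u s - cos (ang s) * v s) * err s + mu * (Z s * D s)
   <= - (1 / 64) * del s ^+ 2.
  move: t1 t2; rewrite !ler_norml => /andP[t1 t1'] /andP[t2 t2'].
  have e1 : Y s * (1 / 80 * (4 * Y s)) = 1 / 20 * Y s ^+ 2 by field.
  have e2 : 1 / 10 ^+ 12 * (24 * 10 ^+ 4 * del s * (27 * del s)) =
     648 / 10 ^+ 8 * del s ^+ 2 by field.
  rewrite e1 in t1 t1'; rewrite e2 in t2 t2'.
  have := sqr_ge0 (Y s); have := sqr_ge0 (del s).
  move: t1 t1' t2 t2' t3 t4; set A := (u s - _) * _; set B := mu * _.
  set dd := del s ^+ 2; set yy := Y s ^+ 2; set uv := _ + v s ^+ 2.
  by move=> *; lra.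
have sg : 0 < speed s * mu by rewrite mulr_gt0//; have := speed_ge s; lra.
rewrite /dV; apply: (le_trans (ler_wpM2l (ltW sg) key)).
have : mu * (1 / 2) <= speed s * mu by rewrite mulrC ler_wpM2r// ltW.
have := sqr_ge0 (del s); set dd := del s ^+ 2; set a := speed s * mu => g1 g2.
have : 0 <= dd * (a - mu * (1 / 2)) by rewrite mulr_ge0// subr_ge0.
by move=> g3; nra.
Qed.

Theorem orbit_in_box_unique s : m s = M (ang s) /\ rho s = P (ang s).
Proof.
have /andP[mu0 mu1] := mus.
(* 2^11 is 2^7 from [dV_le] times 16, which exceeds the 14 of [V_norm]. *)
have k0 : 0 < mu / 2 ^+ 11 by rewrite divr_gt0 ?exprn_gt0.
have decay r : dV r <= - (mu / 2 ^+ 11) * `|V r|.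
  have := dV_le r; have := V_norm r; have := sqr_ge0 (del r).
  set dd := del r ^+ 2; set n := `|V r| => g1 g2 g3.
  have g4 : 0 <= mu * (14 * dd - n) by rewrite mulr_ge0 ?subr_ge0// ltW.
  have g5 : 0 <= mu * dd by rewrite mulr_ge0 // ltW.
  by apply: (le_trans g3); lra.
have bounded r : `|V r| <= 14.
  rewrite (le_trans (V_norm r))// ler_piMr// expr_le1// ?del_ge0//.
  have [g1 g2] := box r; have [g3 g4] := MPbox (ang r).
  have /andP[_ rl] := @box_radius_bounds R.
  have := normB_le g1 g3; have := normB_le g2 g4.
  rewrite (_ : _ - (P (ang r) - c.2) = y r); last by rewrite /y; ring.
  rewrite (_ : _ - (M (ang r) - c.1) = x r); last by rewrite /x; ring.
  by rewrite /del => *; lra.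
have V0 := bounded_lyapunov_eq0 k0 is_derive_V decay bounded.
(* As the form may be indefinite, V = 0 alone does not give x = y = 0; the vanishing derivative
   does, being bounded by a negative multiple of del^2. *)
have dV0 : dV s = 0.
  have := is_derive_V s; rewrite (_ : V = cst 0); last exact/funext.
  by move=> h; rewrite -(@derive_val _ _ _ _ _ _ _ h) derive_cst.
have := dV_le s; rewrite dV0 mulNr oppr_ge0 pmulr_rle0 ?divr_gt0 ?exprn_gt0// => dl.
have : del s == 0 by rewrite -sqrf_eq0 eq_le dl sqr_ge0.
rewrite paddr_eq0// !normr_eq0 !subr_eq0 => /andP[/eqP ? /eqP ?].
by split.
Qed.

End Isolation.

(** * Critical points of the averaged potential *)

Section SimpleZeros.
Variable R : realType.

(** Apart from its linear part, the primitive [F] has the factor sin th, which vanishes at both ends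
    of the turn. *)
Lemma avg_cos_poly (x0 x1 x2 x3 x4 : R) (f : R -> R) :
  (forall th, f th = x0 + x1 * cos th + x2 * cos th ^+ 2 + x3 * cos th ^+ 3
     + x4 * cos th ^+ 4) ->
  avg f = x0 + x2 / 2 + 3 * x4 / 8.
Proof.
move=> fE.
pose F (th : R) := (x0 + x2 / 2 + 3 * x4 / 8) * th
  + sin th * (x1 + x2 / 2 * cos th + x3 * (1 - sin th ^+ 2 / 3)
     + x4 * (3 / 8 * cos th + cos th ^+ 3 / 4)).
have dF (th : R) : is_derive th 1 F (f th).
  rewrite /F; apply: is_derive_eq; rewrite /GRing.scale/= fE.
  have e := sin2cos2 th.
  set C := cos th; set S := sin th; rewrite -/C -/S in e.
  transitivity ((x0 + x2 / 2 + 3 * x4 / 8) + C * (x1 + x2 / 2 * C + x3 * (1 - S ^+ 2 / 3)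
     + x4 * (3 / 8 * C + C ^+ 3 / 4)) - S ^+ 2 * (x2 / 2 + x3 * (2 / 3 * C)
     + x4 * (3 / 8 + 3 / 4 * C ^+ 2))); first by field.
  by rewrite e; field.
rewrite (avgE dF) /F sin2pi sin0 !mul0r mulr0 !addr0 subr0 mulfK//.
by rewrite gt_eqF// turn_gt0.
Qed.

(** The two equations are the critical point equations of [Psi], the second with opposite sign, and
    [h11], [h12], [h22] are its second derivatives. *)
Lemma simple_zeroI (c t : R * R) (t' : R) : center_ok c ->
  c.1 ^+ 3 - c.1 + 3 / 2 * (c.1 * c.2 ^+ 2) = 0 ->
  1 / 2 * c.2 - 3 / 2 * (c.1 ^+ 2 * c.2) - 3 / 8 * c.2 ^+ 3 = 0 ->
  [/\ `|t.1| <= 2, `|t.2| <= 2 & `|t'| <= 2] ->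
  let h11 := 3 * c.1 ^+ 2 - 1 + 3 / 2 * c.2 ^+ 2 in
  let h12 := 3 * (c.1 * c.2) in
  let h22 := (3 * c.1 ^+ 2 - 1) / 2 + 9 / 8 * c.2 ^+ 2 in
  [/\ t.1 * h11 + t' * h12 = 1, t.1 * h12 + t' * h22 = 0,
      t' * h11 + t.2 * h12 = 0 & t' * h12 + t.2 * h22 = 1] ->
  simple_zero c t t'.
Proof.
move=> cok z1 z2 tb h11 h12 h22 [i1 i2 i3 i4].
have e11 : hess11 c = h11.
  rewrite /hess11 (@avg_cos_poly (3 * c.1 ^+ 2 - 1) (- (6 * (c.1 * c.2)))
    (3 * c.2 ^+ 2) 0 0).
    by rewrite /h11; field.
  by move=> th; rewrite /slope; ring.
have e12 : hess12 c = h12.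
  rewrite /hess12 (@avg_cos_poly 0 (- (3 * c.1 ^+ 2 - 1)) (6 * (c.1 * c.2))
    (- (3 * c.2 ^+ 2)) 0).
    by rewrite /h12; field.
  by move=> th; rewrite /slope; ring.
have e22 : hess22 c = h22.
  rewrite /hess22 (@avg_cos_poly 0 0 (3 * c.1 ^+ 2 - 1) (- (6 * (c.1 * c.2)))
    (3 * c.2 ^+ 2)).
    by rewrite /h22; field.
  by move=> th; rewrite /slope; ring.
split; rewrite ?e11 ?e12 ?e22//.
- rewrite (@avg_cos_poly (c.1 ^+ 3 - c.1) (c.2 - 3 * (c.1 ^+ 2 * c.2))
    (3 * (c.1 * c.2 ^+ 2)) (- c.2 ^+ 3) 0); first by rewrite -[RHS]z1; field.
  by move=> th; rewrite /mean_field /cubic; ring.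
- rewrite (@avg_cos_poly 0 (c.1 ^+ 3 - c.1) (c.2 - 3 * (c.1 ^+ 2 * c.2))
    (3 * (c.1 * c.2 ^+ 2)) (- c.2 ^+ 3)); first by rewrite -[RHS]z2; field.
  by move=> th; rewrite /mean_field /cubic; ring.
Qed.

(** The Hessian is the identity at this point. *)
Lemma simple_zero_sym (b : R) : 0 <= b -> b ^+ 2 = 4 / 3 -> simple_zero (0, b) (1, 1) 0.
Proof.
move=> b0 b2; have b3 : b ^+ 3 = 4 / 3 * b by rewrite exprSr b2.
apply: simple_zeroI => /=.
- by split=> /=; [rewrite normr0|apply/andP; split; nra].
- by rewrite !mul0r mulr0 subr0 addr0 expr0n.
- by rewrite b3 expr0n/=; field.
- by split; rewrite ?normr1 ?normr0; lra.
- by rewrite b2 expr0n/=; split; field.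
Qed.

(** The Hessian has diagonal entries 2/5, off-diagonal entry 3 a b and determinant -4/5. The sign of
    a is left free, so both asymmetric centers are covered. *)
Lemma simple_zero_asym (a b : R) : 0 <= b -> a ^+ 2 = 1 / 5 -> b ^+ 2 = 8 / 15 ->
  simple_zero (a, b) (- 1 / 2, - 1 / 2) (15 / 4 * (a * b)).
Proof.
move=> b0 a2 b2.
have b3 : b ^+ 3 = 8 / 15 * b by rewrite exprSr b2.
have a3 : a ^+ 3 = 1 / 5 * a by rewrite exprSr a2.
have ab : (a * b) * (a * b) = 8 / 75 by rewrite mulrACA -!expr2 a2 b2; field.
have abn : `|a * b| <= 8 / 15.
  by rewrite ler_norml; apply/andP; split; nra.
apply: simple_zeroI => /=.
- by split=> /=; [rewrite ler_norml; apply/andP; split; nra|apply/andP; split; nra].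
- by rewrite a3 b2; field.
- by rewrite a2 b3; field.
- split; [| |].
  + by rewrite ler_norml; apply/andP; split; lra.
  + by rewrite ler_norml; apply/andP; split; lra.
  + by move: abn; rewrite !ler_norml => /andP[? ?]; apply/andP; split; lra.
- rewrite a2 b2; split.
  + transitivity (- 1 / 2 * (2 / 5) + 45 / 4 * ((a * b) * (a * b))); first by field.
    by rewrite ab; field.
  + by field.
  + by field.
  + transitivity (- 1 / 2 * (2 / 5) + 45 / 4 * ((a * b) * (a * b))); first by field.
    by rewrite ab; field.
Qed.

End SimpleZeros.

(** * From polar coordinates to the Chua system *)

Section CircleFlow.
Variable R : realType.

Lemma derive_ge_surjective (f df : R -> R) (k : R) : 0 < k ->
  (forall x : R, is_derive x 1 f (df x)) -> (forall x, k <= df x) ->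
  forall y, exists x, f x = y.
Proof.
move=> k0 fdf dfk y.
have grow a b : a <= b -> k * (b - a) <= f b - f a.
  by move=> ab; have [c _ ->] := mean_value ab fdf; rewrite ler_wpM2r ?subr_ge0.
pose L := `|y - f 0| / k.
have L0 : 0 <= L by rewrite divr_ge0// ltW.
have kL : k * L = `|y - f 0| by rewrite mulrC divfK// gt_eqF.
have NL : - L <= L by lra.
have h1 := grow 0 L L0; have := grow (- L) 0; rewrite oppr_le0 => /(_ L0) h2.
rewrite subr0 kL in h1; rewrite sub0r opprK kL in h2.
have cf : {within `[- L, L], continuous f}.
  exact/continuous_subspaceT/(is_derive_continuous fdf).
have [|x _ <-] := IVT NL cf (v := y); last by exists x.
have := lexx `|y - f 0|; rewrite {1}ler_norml => /andP[y1 y2].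
rewrite ge_min le_max; apply/andP; split; apply/orP; [left|right]; lra.
Qed.

(** Separation of variables: the time needed to reach an angle is a primitive of 1 / w, its inverse
    function is the flow, and the time of one turn is the period. *)
Lemma circle_flow (w : R -> R) : continuous w -> periodic w (turn R) ->
  (forall x, 1 / 2 <= w x <= 4) ->
  exists (ang : R -> R) (T : R),
    [/\ 0 < T, forall s : R, is_derive s 1 ang (w (ang s)),
        forall s, ang (s + T) = ang s + turn R & forall x, exists s, ang s = x].
Proof.
move=> cw wT wb.
have w0 x : 0 < w x by have /andP[? _] := wb x; lra.
have cv : continuous (fun x => (w x)^-1).
  by apply: continuous_invfun => // x; rewrite gt_eqF.
have [tau tau0 dtau] := continuous_primitive cv.
have grow x y : x <= y -> (y - x) / 4 <= tau y - tau x.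
  move=> xy; have [c _ ->] := mean_value xy dtau.
  rewrite mulrC ler_wpM2r ?subr_ge0// lef_pV2 ?posrE//.
  by have /andP[] := wb c.
have tau_inj : injective tau.
  move=> x y e; apply/eqP; rewrite eq_le; apply/andP; split.
    by rewrite leNgt; apply/negP => xy; have := grow _ _ (ltW xy); rewrite e subrr; lra.
  by rewrite leNgt; apply/negP => xy; have := grow _ _ (ltW xy); rewrite e subrr; lra.
have tau_surj s : exists x, tau x = s.
  have k0 : 0 < 1 / 4 :> R by lra.
  apply: (derive_ge_surjective k0 dtau) => x.
  by rewrite div1r lef_pV2 ?posrE//; have /andP[] := wb x.
have [ang angK] := choice tau_surj.
have tauK : cancel tau ang by move=> x; apply: tau_inj; rewrite angK.
have tauT x : tau (x + turn R) = tau x + tau (turn R).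
  pose g := (tau \o (fun z => z + turn R)) \- tau.
  have dg (y : R) : is_derive y 1 g 0.
    have := dtau y => d1; have := dtau (y + turn R) => d2.
    have d3 : is_derive y 1 (tau \o (fun z => z + turn R)) ((w (y + turn R))^-1 * 1).
      by apply: is_derive1_comp; apply: is_derive_eq; rewrite addr0.
    by apply: is_derive_eq; rewrite wT mulr1 subrr.
  have := derive0_constant dg x 0; rewrite /g/= add0r tau0 subr0 => h.
  by lra.
exists ang, (tau (turn R)); split.
- have := grow _ _ (ltW (turn_gt0 R)); rewrite tau0 !subr0; apply: lt_le_trans.
  by rewrite divr_gt0// turn_gt0.
- move=> s; rewrite -{1}(angK s) -[w _]invrK.
  apply: is_derive_inverse => //.
  + by near=> y; exact: tauK.
  + near=> y; apply/differentiable_continuous/derivable1_diffP.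
    by case: (dtau y).
  + by rewrite invr_eq0 gt_eqF.
- by move=> s; apply: tau_inj; rewrite angK tauT angK.
- by move=> x; exists (tau x).
Unshelve. all: by end_near. Qed.

Lemma exists_angle (x y : R) : x ^+ 2 + y ^+ 2 = 1 -> exists th, cos th = x /\ sin th = y.
Proof.
move=> xy; have x1 : -1 <= x <= 1.
  by apply/andP; split; have := sqr_ge0 y; nra.
have yE : Num.sqrt (1 - x ^+ 2) = `|y| by rewrite -xy addrAC subrr add0r sqrtr_sqr.
have [y0|y0] := leP 0 y.
  by exists (acos x); rewrite acosK// sin_acos// yE ger0_norm.
by exists (- acos x); rewrite cosN sinN acosK// sin_acos// yE ltr0_norm// opprK.
Qed.

(** The angle is an initial angle plus a primitive of W. In the frame rotating with it, both
    coordinates satisfy the linear equation of rho, so their ratios to rho keep the initial values 1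
    and 0. *)
Lemma angle_lift (w z rho k W : R -> R) : continuous W -> (forall s, 0 < rho s) ->
  w 0 ^+ 2 + z 0 ^+ 2 = rho 0 ^+ 2 ->
  (forall s : R, is_derive s 1 w (k s * w s - W s * z s)) ->
  (forall s : R, is_derive s 1 z (k s * z s + W s * w s)) ->
  (forall s : R, is_derive s 1 rho (k s * rho s)) ->
  exists ang : R -> R, (forall s : R, is_derive s 1 ang (W s)) /\
    forall s, w s = rho s * cos (ang s) /\ z s = rho s * sin (ang s).
Proof.
move=> cW rho0 e0 dw dz drho.
have rn0 s : rho s != 0 by rewrite gt_eqF.
have [th [cth sth]] : exists th, cos th = w 0 / rho 0 /\ sin th = z 0 / rho 0.
  apply: exists_angle; rewrite !expr_div_n -mulrDl e0 mulfV//.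
  by rewrite expf_eq0/= (negbTE (rn0 0)).
have [F F0 dF] := continuous_primitive cW.
pose ang s := th + F s.
have dang (s : R) : is_derive s 1 ang (W s).
  have := dF s => ?; have : is_derive s 1 (fun s => th + F s) (W s); last by [].
  by apply: is_derive_eq; ring.
have const (A : R -> R) : (forall s : R, is_derive s 1 A (k s * A s)) ->
    forall s, A s = A 0 / rho 0 * rho s.
  move=> dA s; have dq (r : R) : is_derive r 1 (fun r => A r * (rho r)^-1) 0.
    have := is_deriveV (rn0 r) (drho r) => d1; have := dA r => d2.
    apply: is_derive_eq; rewrite /GRing.scale/=.
    by field; exact: rn0.
  by have := derive0_constant dq s 0 => /= <-; rewrite mulfVK.
pose A s := w s * cos (ang s) + z s * sin (ang s).
pose B s := z s * cos (ang s) - w s * sin (ang s).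
have dA (r : R) : is_derive r 1 A (k r * A r).
  have := dw r => d1; have := dz r => d2; have := dang r => d3.
  by rewrite /A; apply: is_derive_eq; rewrite /GRing.scale/=; ring.
have dB (r : R) : is_derive r 1 B (k r * B r).
  have := dw r => d1; have := dz r => d2; have := dang r => d3.
  by rewrite /B; apply: is_derive_eq; rewrite /GRing.scale/=; ring.
have AE s : A s = rho s.
  rewrite (const A dA) /A /ang F0 addr0 cth sth.
  have -> : w 0 * (w 0 / rho 0) + z 0 * (z 0 / rho 0) = rho 0 ^+ 2 / rho 0.
    by rewrite -e0; ring.
  by field; exact: rn0.
have BE s : B s = 0.
  by rewrite (const B dB) /B /ang F0 addr0 cth sth mulrCA subrr !mul0r.
exists ang; split => // s; have cs := cos2Dsin2 (ang s); split.
  transitivity (A s * cos (ang s) - B s * sin (ang s)); last by rewrite AE BE mul0r subr0.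
  by rewrite -[LHS]mulr1 -cs /A /B; ring.
transitivity (A s * sin (ang s) + B s * cos (ang s)); last by rewrite AE BE mul0r addr0.
by rewrite -[LHS]mulr1 -cs /A /B; ring.
Qed.

End CircleFlow.

Section Vec3.
Variable R : realType.

Lemma vec3E0 (x y z : R) : vec3 x y z 0 0 = x. Proof. by rewrite mxE. Qed.
Lemma vec3E1 (x y z : R) : vec3 x y z 0 1 = y. Proof. by rewrite mxE. Qed.
Lemma vec3E2 (x y z : R) : vec3 x y z 0 2 = z. Proof. by rewrite mxE. Qed.

Definition vec3E := (vec3E0, vec3E1, vec3E2).

Lemma vec3_eta (v : 'rV[R]_3) : vec3 (v 0 0) (v 0 1) (v 0 2) = v.
Proof.
apply/rowP => i; rewrite mxE.
by case: i => -[|[|[|//]]] i3 /=; congr (v 0 _); exact/val_inj.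
Qed.

Lemma is_derive_vec3P (g : R -> 'rV[R]_3) (t : R) (v : 'rV[R]_3) :
  is_derive (t : R^o) 1 (g : R^o -> 'rV[R]_3) v <->
  forall i, is_derive t 1 (fun s => g s 0 i) (v 0 i).
Proof.
split=> [[dg <-] i|H].
  rewrite (derive_mx dg) mxE; apply: DeriveDef => //.
  exact: (derivable_mxP _ _ _).1 dg 0 i.
have dg : derivable (g : R^o -> 'rV[R]_3) t 1.
  by apply/derivable_mxP => i j; rewrite (ord1 i); case: (H j).
apply: DeriveDef => //; rewrite (derive_mx dg); apply/rowP => j; rewrite !mxE.
by case: (H j).
Qed.

Lemma is_derive_vec3 (x y z : R -> R) (t x' y' z' : R) :
  is_derive t 1 x x' -> is_derive t 1 y y' -> is_derive t 1 z z' ->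
  is_derive (t : R^o) 1 ((fun s => vec3 (x s) (y s) (z s)) : R^o -> 'rV[R]_3)
    (vec3 x' y' z').
Proof.
move=> dx dy dz; apply/is_derive_vec3P => i; rewrite mxE.
under eq_fun do rewrite mxE.
by case: i => -[|[|[|//]]] i3 /=.
Qed.

End Vec3.

Section ChuaCycles.
Variable R : realType.

Definition root2 : R := Num.sqrt 2.

Lemma root2_sqr : root2 ^+ 2 = 2. Proof. by rewrite sqr_sqrtr. Qed.

Lemma root2_bounds : 7 / 5 <= root2 <= 3 / 2.
Proof.
have s := root2_sqr; have g : 0 <= root2 := sqrtr_ge0 _.
by apply/andP; split; nra.
Qed.

Lemma root2_gt0 : 0 < root2. Proof. by have /andP[? _] := root2_bounds; lra. Qed.

Lemma root2_neq0 : root2 != 0. Proof. by rewrite gt_eqF// root2_gt0. Qed.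

(* For omega ^ 2 = 2 the slow equations for m and rho have equal coefficients, and
   for zeta2 = 0 there is no linear damping: this is what makes the averaged
   system a gradient flow for the Euclidean metric. *)
Definition cycle_constants : chua_constants R :=
  ChuaConstants (2 * root2) 1 0 0 0 0 0 0 0 (-1) 0 0 root2.

Lemma cycle_constants_admissible : admissible cycle_constants.
Proof.
split=> /=; rewrite ?mul1r ?root2_neq0 ?oppr_lt0//.
by rewrite mulf_neq0 ?root2_neq0.
Qed.

Definition cycle_field (e : R) : 'rV[R]_3 -> 'rV[R]_3 := chua_family cycle_constants e.

Lemma cycle_fieldE e x y z : cycle_field e (vec3 x y z) =
  vec3 (2 * root2 * (z + e ^+ 2 * x - x ^+ 3)) (- z) (y - x / (2 * root2)).
Proof.
rewrite /cycle_field /chua_family /chua !vec3E.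
rewrite /par_a /par_a1 /par_a2 /par_b /par_b1 /par_b2 /=.
rewrite root2_sqr !mulr0 !addr0.
by congr vec3; rewrite ?/par_a2 ?/par_a1 ?/par_a /=; field; rewrite ?root2_neq0.
Qed.

(** At e = 0 the linear part has the kernel spanned by (1, 1 / (2 sqrt 2), 0), measured by m, and an
    invariant plane of rotation, measured by rho and th. The factor e is the blow-up that leaves mu
    = e^2 as the only parameter. *)
Definition polar_point e m rho th : 'rV[R]_3 :=
  vec3 (e * (m - rho * cos th)) (e * (m + rho * cos th) / (2 * root2))
       (e * (rho * sin th) / 2).

(** The derivative of the angle in the original time; [root2] is the frequency omega. *)
Definition ang_speed mu th m rho : R := root2 * (polar_denom mu th m rho / rho).

Section solution.
Variables (e : R) (c : R * R).
Let mu := e ^+ 2.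
Hypotheses (e0 : 0 < e) (mus : mu_small mu) (cok : center_ok c).

Let box_rho_gt0 m rho : in_box c m rho -> 0 < rho.
Proof. by move=> /(box_rho cok)/andP[? _]; lra. Qed.

Lemma ang_speed_bounds th m rho : in_box c m rho -> 1 / 2 <= ang_speed mu th m rho <= 4.
Proof.
move=> b; have r0 := box_rho_gt0 b; have /andP[mu0 mu1] := mus.
have /andP[r1 r2] := box_rho cok b.
have h : `|mu * sin th * cubic (m - rho * cos th)| <= 1 / 10 ^+ 12 * 1 * 68.
  have mn : `|mu| <= 1 / 10 ^+ 12 by rewrite gtr0_norm.
  exact: normM_le (normM_le mn (sin_max _)) (box_cubic th cok b).
have q : 9 / 10 <= polar_denom mu th m rho / rho <= 11 / 10.
  rewrite ler_pdivlMr// ler_pdivrMr// /polar_denom.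
  by move: h; rewrite ler_norml => /andP[h1 h2]; apply/andP; split; lra.
have /andP[s1 s2] := root2_bounds; rewrite /ang_speed.
move: q; set d := _ / rho => /andP[d1 d2].
by apply/andP; split; nra.
Qed.

Lemma ang_speed_rate th m rho : in_box c m rho ->
  ang_speed mu th m rho * polar_rate mu th m rho = root2 * cubic (m - rho * cos th).
Proof.
move=> b; rewrite /ang_speed /polar_rate.
have d0 := box_denom_gt0 th cok b mus; have r0 := box_rho_gt0 b.
by field; rewrite !gt_eqF.
Qed.

Lemma ang_speed_continuous (a m rho : R -> R) : (forall s, in_box c (m s) (rho s)) ->
  continuous a -> continuous m -> continuous rho ->
  continuous (fun s => ang_speed mu (a s) (m s) (rho s)).
Proof.
move=> b ca cm cr.
apply: continuous_mulfun; first exact: continuous_cstfun.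
apply: continuous_mulfun; first exact: continuous_polar_denom.
by apply: continuous_invfun => // s; rewrite gt_eqF// (box_rho_gt0 (b s)).
Qed.

Lemma polar_point_solution (m rho ang : R -> R) (t : R) : in_box c (m t) (rho t) ->
  let speed := ang_speed mu (ang t) (m t) (rho t) in
  let rate := polar_rate mu (ang t) (m t) (rho t) in
  is_derive t 1 ang speed ->
  is_derive t 1 m (- (speed * (mu * rate))) ->
  is_derive t 1 rho (speed * (mu * (cos (ang t) * rate))) ->
  is_derive (t : R^o) 1 ((fun s => polar_point e (m s) (rho s) (ang s)) : R^o -> 'rV[R]_3)
    (cycle_field e (polar_point e (m t) (rho t) (ang t))).
Proof.
move=> b /=.
have := ang_speed_rate (ang t) b.
have : ang_speed mu (ang t) (m t) (rho t) =
   root2 * (1 - mu * sin (ang t) * cubic (m t - rho t * cos (ang t)) / rho t).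
  by rewrite /ang_speed /polar_denom; field; rewrite gt_eqF// (box_rho_gt0 b).
set W := ang_speed _ _ _ _; set Q := polar_rate _ _ _ _; set P := cubic _.
move=> WE WQ dang dm drho.
have r0 : rho t != 0 by rewrite gt_eqF// (box_rho_gt0 b).
have {}dm : is_derive t 1 m (- (mu * (root2 * P))).
  by rewrite (_ : mu * _ = W * (mu * Q))// -WQ; ring.
have {}drho : is_derive t 1 rho (mu * (cos (ang t) * (root2 * P))).
  by rewrite (_ : mu * _ = W * (mu * (cos (ang t) * Q)))// -WQ; ring.
have dcos : is_derive t 1 (fun s => rho s * cos (ang s))
    (root2 * (mu * P - rho t * sin (ang t))).
  apply: is_derive_eq; rewrite /GRing.scale/= WE.
  transitivity (root2 * (mu * P * (cos (ang t) ^+ 2 + sin (ang t) ^+ 2)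
    - rho t * sin (ang t))).
    by field.
  by rewrite cos2Dsin2 mulr1.
have dsin : is_derive t 1 (fun s => rho s * sin (ang s)) (root2 * (rho t * cos (ang t))).
  by apply: is_derive_eq; rewrite /GRing.scale/= WE; field.
rewrite /polar_point cycle_fieldE.
have q2 := root2_sqr; have q0 := root2_neq0.
apply: is_derive_vec3.
- apply: is_derive_eq; rewrite /GRing.scale/=.
  by rewrite /P /cubic /mu; field.
- apply: is_derive_eq; rewrite /GRing.scale/=.
  by field.
- apply: is_derive_eq; rewrite /GRing.scale/=.
  transitivity (e * (rho t * cos (ang t)) * root2 ^+ 2 / (2 * root2)); first by field.
  by rewrite q2; field.
Qed.

Definition slow_coord (p : 'rV[R]_3) : R := (p 0 0 + 2 * root2 * p 0 1) / (2 * e).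
Definition cos_coord (p : 'rV[R]_3) : R := (2 * root2 * p 0 1 - p 0 0) / (2 * e).
Definition sin_coord (p : 'rV[R]_3) : R := 2 * p 0 2 / e.
Definition amplitude (p : 'rV[R]_3) : R := Num.sqrt (cos_coord p ^+ 2 + sin_coord p ^+ 2).

Lemma polar_point_coords m rho th :
  [/\ slow_coord (polar_point e m rho th) = m,
      cos_coord (polar_point e m rho th) = rho * cos th &
      sin_coord (polar_point e m rho th) = rho * sin th].
Proof.
have q0 := root2_neq0; have en0 : e != 0 by rewrite gt_eqF.
rewrite /slow_coord /cos_coord /sin_coord /polar_point !vec3E.
by split; field; rewrite ?q0 ?en0.
Qed.

Lemma polar_pointK p m rho th : slow_coord p = m -> cos_coord p = rho * cos th ->
  sin_coord p = rho * sin th -> p = polar_point e m rho th.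
Proof.
move=> h1 h2 h3; have q0 := root2_neq0; have en0 : e != 0 by rewrite gt_eqF.
rewrite /polar_point -h1 -h2 -h3 /slow_coord /cos_coord /sin_coord.
rewrite -[LHS]vec3_eta; congr vec3; field; by rewrite ?q0 ?en0.
Qed.

Lemma amplitude_polar m rho th : 0 <= rho -> amplitude (polar_point e m rho th) = rho.
Proof.
move=> r0; rewrite /amplitude; have [_ -> ->] := polar_point_coords m rho th.
by rewrite !exprMn -mulrDr cos2Dsin2 mulr1 sqrtr_sqr ger0_norm.
Qed.

Lemma orbit_polar (g : R -> 'rV[R]_3) : solves (cycle_field e) setT g ->
  (forall s, in_box c (slow_coord (g s)) (amplitude (g s))) ->
  exists ang : R -> R,
  let m := fun s => slow_coord (g s) in let rho := fun s => amplitude (g s) in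
  let speed := fun s => ang_speed mu (ang s) (m s) (rho s) in
  let rate := fun s => polar_rate mu (ang s) (m s) (rho s) in
  [/\ forall s, g s = polar_point e (m s) (rho s) (ang s),
      forall s : R, is_derive s 1 ang (speed s),
      forall s : R, is_derive s 1 m (- (speed s * (mu * rate s))) &
      forall s : R, is_derive s 1 rho (speed s * (mu * (cos (ang s) * rate s)))].
Proof.
move=> sol b.
pose m s := slow_coord (g s); pose rho s := amplitude (g s).
pose w s := cos_coord (g s); pose z s := sin_coord (g s).
have q2 := root2_sqr; have q0 := root2_neq0; have en0 : e != 0 by rewrite gt_eqF.
have r0 s : 0 < rho s := box_rho_gt0 (b s).
have rn0 s : rho s != 0 by rewrite gt_eqF.
pose x s := g s 0 0; pose y s := g s 0 1; pose u s := g s 0 2.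
have dg (s : R) i : is_derive s 1 (fun s => g s 0 i)
    (vec3 (2 * root2 * (u s + e ^+ 2 * x s - x s ^+ 3)) (- u s)
       (y s - x s / (2 * root2)) 0 i).
  by rewrite -cycle_fieldE vec3_eta; have /is_derive_vec3P := sol s I; exact.
have dx (s : R) : is_derive s 1 x (2 * root2 * (u s + e ^+ 2 * x s - x s ^+ 3)).
  by have := dg s 0; rewrite vec3E.
have dy (s : R) : is_derive s 1 y (- u s) by have := dg s 1; rewrite vec3E.
have du (s : R) : is_derive s 1 u (y s - x s / (2 * root2)).
  by have := dg s 2; rewrite vec3E.
have mE : m = fun s => (x s + 2 * root2 * y s) / (2 * e) by [].
have wE : w = fun s => (2 * root2 * y s - x s) / (2 * e) by [].
have zE : z = fun s => 2 * u s / e by [].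
pose P s := cubic (m s - w s).
have XE s : m s - w s = x s / e by rewrite mE wE; field.
have dm (s : R) : is_derive s 1 m (- (mu * (root2 * P s))).
  rewrite /P XE mE; have d1 := dx s; have d2 := dy s.
  by apply: is_derive_eq; rewrite /GRing.scale/= /cubic /mu; field.
have dw (s : R) : is_derive s 1 w (root2 * (mu * P s - z s)).
  rewrite /P XE wE zE; have d1 := dx s; have d2 := dy s.
  by apply: is_derive_eq; rewrite /GRing.scale/= /cubic /mu; field.
have dz (s : R) : is_derive s 1 z (root2 * w s).
  rewrite wE zE; have d1 := du s.
  apply: is_derive_eq; rewrite /GRing.scale/=.
  transitivity ((2 * root2 * y s - x s) * root2 ^+ 2 / (2 * root2 * e)).
    by rewrite q2; field; rewrite q0 en0.
  by field; rewrite q0 en0.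
have rsq s : rho s ^+ 2 = w s ^+ 2 + z s ^+ 2.
  by rewrite sqr_sqrtr// addr_ge0// sqr_ge0.
have drho (s : R) : is_derive s 1 rho (root2 * (mu * (w s * P s)) / rho s).
  have pos : 0 < w s ^+ 2 + z s ^+ 2 by rewrite -rsq exprn_gt0.
  have := is_derive1_sqrt pos; have := dw s; have := dz s => d1 d2 d3.
  have : is_derive s 1 (Num.sqrt \o (fun s => w s ^+ 2 + z s ^+ 2))
      (root2 * (mu * (w s * P s)) / rho s).
    apply: is_derive_eq; rewrite /GRing.scale/=.
    by set r := _^-1; have -> : r = (2 * rho s)^-1 by []; field.
  by [].
(* The angular speed and the radial rate are written in terms of w, z and rho, since no angle is
   available yet; [WE] identifies W with [ang_speed] once it is. *)
pose W s := root2 * (1 - mu * z s * P s / rho s ^+ 2).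
pose k s := root2 * (mu * (w s * P s)) / rho s ^+ 2.
have cW : continuous W.
  have cm := is_derive_continuous dm; have cw := is_derive_continuous dw.
  have cz := is_derive_continuous dz; have cr := is_derive_continuous drho.
  have cP : continuous P by exact/continuous_cubicfun/continuous_subfun.
  apply: continuous_mulfun; first exact: continuous_cstfun.
  apply: continuous_subfun; first exact: continuous_cstfun.
  apply: continuous_mulfun.
    apply: continuous_mulfun => //.
    by apply: continuous_mulfun => //; exact: continuous_cstfun.
  apply: continuous_invfun; last exact: continuous_sqrfun.
  by move=> s; rewrite expf_eq0/= rn0.
have [||||ang [dang angE]] := @angle_lift R w z rho k W cW r0.
- by rewrite rsq.
- move=> s; have := dw s; rewrite (_ : root2 * _ = k s * w s - W s * z s)//.
  rewrite /k /W; transitivity (root2 * (mu * P s * (rho s ^+ 2 / rho s ^+ 2) - z s)).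
    by rewrite divff ?mulr1// expf_neq0.
  by rewrite [X in X / _]rsq; field.
- move=> s; have := dz s; rewrite (_ : root2 * _ = k s * z s + W s * w s)//.
  by rewrite /k /W; field.
- move=> s; have := drho s; rewrite (_ : _ / rho s = k s * rho s)//.
  by rewrite /k; field.
exists ang => /=.
have WE s : W s = ang_speed mu (ang s) (m s) (rho s).
  rewrite /W /ang_speed /polar_denom /P.
  have [<- zang] := angE s; rewrite {1}zang.
  by field.
have PE s : root2 * P s =
    ang_speed mu (ang s) (m s) (rho s) * polar_rate mu (ang s) (m s) (rho s).
  by rewrite (ang_speed_rate _ (b s)) /P; have [-> _] := angE s.
split=> s.
- by have [? ?] := angE s; exact: polar_pointK.
- by rewrite -/(m s) -/(rho s) -WE.
- have := dm s; rewrite PE -/(m s) -/(rho s).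
  by rewrite (mulrCA mu).
- have := drho s; rewrite (_ : _ / rho s = mu * (cos (ang s) * (root2 * P s))).
    by rewrite PE (_ : mu * _ = ang_speed mu (ang s) (m s) (rho s) *
      (mu * (cos (ang s) * polar_rate mu (ang s) (m s) (rho s))))//; ring.
  by have [-> _] := angE s; field.
Qed.

End solution.

End ChuaCycles.

(** * Limit cycles of the chosen system *)

Section LimitCycles.
Variable R : realType.

Lemma entry_continuous (i : 'I_3) : continuous (fun p : 'rV[R]_3 => p 0 i).
Proof. exact: coord_continuous. Qed.

Lemma slow_coord_continuous (e : R) : continuous (slow_coord e).
Proof.
apply: continuous_mulfun; last exact: continuous_cstfun.
apply: continuous_addfun; first exact: entry_continuous.
by apply: continuous_mulfun; [exact: continuous_cstfun|exact: entry_continuous].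
Qed.

Lemma cos_coord_continuous (e : R) : continuous (cos_coord e).
Proof.
apply: continuous_mulfun; last exact: continuous_cstfun.
apply: continuous_subfun; last exact: entry_continuous.
by apply: continuous_mulfun; [exact: continuous_cstfun|exact: entry_continuous].
Qed.

Lemma sin_coord_continuous (e : R) : continuous (sin_coord e).
Proof.
apply: continuous_mulfun; last exact: continuous_cstfun.
by apply: continuous_mulfun; [exact: continuous_cstfun|exact: entry_continuous].
Qed.

Lemma amplitude_continuous (e : R) : continuous (amplitude e).
Proof.
move=> p.
apply: (@continuous_comp _ _ _ (fun p => cos_coord e p ^+ 2 + sin_coord e p ^+ 2)).
  apply: continuous_addfun; apply: continuous_sqrfun.
    exact: cos_coord_continuous.
  exact: sin_coord_continuous.
exact: sqrt_continuous.
Qed.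

Lemma open_dist_lt (T : topologicalType) (f : T -> R) (a r : R) : continuous f ->
  open [set p | `|f p - a| < r].
Proof.
move=> cf; have cg : continuous (fun p => `|f p - a|).
  move=> p; apply: cvg_norm; apply: continuous_subfun => //.
  exact: continuous_cstfun.
by apply: (@open_comp _ _ (fun p => `|f p - a|) [set x | x < r]) => [p _|];
  [exact: cg|exact: open_lt].
Qed.

Lemma chua_limit_cycle (e : R) (c t : R * R) (t' : R) :
  0 < e -> mu_small (e ^+ 2) -> simple_zero c t t' ->
  exists O, limit_cycle (cycle_field e) O /\
    forall p, O p -> exists m rho th, in_box c m rho /\ p = polar_point e m rho th.
Proof.
move=> e0 mus nd; have cok := nd_center nd.
have [M [P [MT PT strict dM dP]]] := periodic_solution mus nd.
have MPbox th : in_box c (M th) (P th) by have [? ?] := strict th; split; exact: ltW.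
have P0 th : 0 < P th by have /andP[? _] := box_rho cok (MPbox th); lra.
have cM := is_derive_continuous dM; have cP := is_derive_continuous dP.
pose w x := ang_speed (e ^+ 2) x (M x) (P x).
have cw : continuous w.
  by apply: (ang_speed_continuous (c := c)) => // x; exact: cvg_id.
have wT : periodic w (turn R).
  by move=> x; rewrite /w /ang_speed /polar_denom MT PT cosD2pi sinD2pi.
have [ang [T [T0 dang angT ang_surj]]] :=
  circle_flow cw wT (fun x => ang_speed_bounds mus cok x (MPbox x)).
pose f th := polar_point e (M th) (P th) th.
pose g s := f (ang s).
have sol : solves (cycle_field e) setT g.
  move=> s _; apply: (@polar_point_solution _ e c mus cok (M \o ang) (P \o ang) ang s).
  - exact: MPbox.
  - have := dM (ang s); have := dang s => d1 d2.
    by apply: is_derive_eq; rewrite /w /=; ring.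
  - have := dP (ang s); have := dang s => d1 d2.
    by apply: is_derive_eq; rewrite /w /=; ring.
have gT s : g (s + T) = g s.
  by rewrite /g angT /f /polar_point MT PT cosD2pi sinD2pi.
have rg : range f = range g.
  apply/seteqP; split=> p [x _ <-].
    by have [s <-] := ang_surj x; exists s.
  by exists (ang x).
exists (range f); split; last by move=> p [th _ <-]; exists (M th), (P th), th.
split.
  exists g, T; split => //.
  (* The orbit is not constant: the coordinate rho cos th is positive at angle 0 and negative at
     angle pi. *)
  apply: contrapT => /forallNP gc.
  have gE s : g s = g 0 by apply: contrapT; exact: gc.
  have [s0 s0E] := ang_surj 0; have [s1 s1E] := ang_surj pi.
  have fE : f 0 = f pi by rewrite -s0E -s1E -/(g s0) -/(g s1) !gE.
  have [_ h0 _] := polar_point_coords e0 (M 0) (P 0) 0.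
  have [_ h1 _] := polar_point_coords e0 (M pi) (P pi) pi.
  have : cos_coord e (f 0) = cos_coord e (f pi) by rewrite fE.
  rewrite h0 h1 cos0 cospi mulr1 mulrN1 => h.
  by have := P0 0; have := P0 pi; rewrite h => *; lra.
(* The open box without restriction on the angle is a solid torus around the cycle. *)
exists [set p | `|slow_coord e p - c.1| < box_radius R /\
  `|amplitude e p - c.2| < box_radius R].
split.
- apply: openI; apply: open_dist_lt.
    exact: slow_coord_continuous.
  exact: amplitude_continuous.
- move=> p [th _ <-] /=; have [h _ _] := polar_point_coords e0 (M th) (P th) th.
  by rewrite h amplitude_polar// ltW.
- move=> O' [g' [T' [sol' T'0 g'T' _ ->]]] sub.
  have box' s : in_box c (slow_coord e (g' s)) (amplitude e (g' s)).
    by have [h1 h2] : _ /\ _ := sub (g' s) (ex_intro2 _ _ s I erefl); split; exact: ltW.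
  have [ang' [g'E dang' dm' drho']] := orbit_polar e0 mus cok sol' box'.
  have speed_ge s : 1 / 2 <=
      ang_speed (e ^+ 2) (ang' s) (slow_coord e (g' s)) (amplitude e (g' s)).
    by have /andP[] := ang_speed_bounds mus cok (ang' s) (box' s).
  have uniq s := orbit_in_box_unique mus nd MPbox dM dP box' speed_ge dm' drho' dang' s.
  have g'f s : g' s = f (ang' s) by rewrite g'E; have [-> ->] := uniq s.
  apply/seteqP; split=> p [x _ <-].
    by exists (ang' x).
  (* The angular speed is bounded below, so the competing orbit passes through every angle and
     covers the whole cycle. *)
  have half : 0 < 1 / 2 :> R by lra.
  have [s <-] := derive_ge_surjective half dang' speed_ge x.
  by exists s.
Qed.

Definition center (i : 'I_3) : R * R :=
  [:: (0, Num.sqrt (4 / 3)); (Num.sqrt (1 / 5), Num.sqrt (8 / 15));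
      (- Num.sqrt (1 / 5), Num.sqrt (8 / 15))]`_i.

Lemma center_simple_zero i : exists t t', simple_zero (center i) t t'.
Proof.
have s1 : Num.sqrt (4 / 3) ^+ 2 = 4 / 3 :> R by rewrite sqr_sqrtr//; lra.
have s2 : Num.sqrt (1 / 5) ^+ 2 = 1 / 5 :> R by rewrite sqr_sqrtr//; lra.
have s3 : Num.sqrt (8 / 15) ^+ 2 = 8 / 15 :> R by rewrite sqr_sqrtr//; lra.
case: i => -[|[|[|//]]] i3; rewrite /center /=.
- by exists (1, 1), 0; apply: simple_zero_sym; rewrite ?sqrtr_ge0.
- by do 2 eexists; apply: simple_zero_asym; rewrite ?sqrtr_ge0.
- by do 2 eexists; apply: simple_zero_asym; rewrite ?sqrtr_ge0 ?sqrrN.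
Qed.

(** The slow coordinate alone separates the boxes: the values 0 and +- sqrt (1/5) are at least 1/10
    apart, while the radius is at most 1/100. *)
Lemma center_inj i j m r m' r' : in_box (center i) m r -> in_box (center j) m' r' ->
  m = m' -> i = j.
Proof.
have s2 : Num.sqrt (1 / 5) ^+ 2 = 1 / 5 :> R by rewrite sqr_sqrtr//; lra.
have s0 : 0 <= Num.sqrt (1 / 5) :> R := sqrtr_ge0 _.
have s4 : 1 / 10 <= Num.sqrt (1 / 5) :> R by nra.
have /andP[r0 r1] := @box_radius_bounds R.
move=> [+ _] [+ _] e; rewrite -e.
case: i => -[|[|[|//]]] i3; case: j => -[|[|[|//]]] j3;
  rewrite /center /= ?subr0 ?opprK !ler_norml;
  move=> /andP[? ?] /andP[? ?]; try exact/val_inj; exfalso; lra.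
Qed.

Lemma p_minus0 (c : chua_constants R) : p_minus c 0 = 0.
Proof.
have a2 : par_a2 c 0 = 0 by rewrite /par_a2 expr0n /= !mul0r addr0.
have d0 : discr c 0 = 0.
  by rewrite /discr /par_b a2 !expr0n /= !mul0r addr0 mulr0 subr0.
rewrite /p_minus d0 a2 sqrtr0 !(oppr0, mul0r, mulr0, subr0).
by apply/rowP => i; rewrite !mxE; case: i => -[|[|[|//]]].
Qed.

Lemma polar_point_norm (c : R * R) e m rho th : 0 <= e -> center_ok c -> in_box c m rho ->
  `|polar_point e m rho th| <= 4 * e.
Proof.
move=> e0 cok b; have xn := box_x th cok b.
have /andP[r1 r2] := box_rho cok b; have mn := box_m cok b.
have en : `|e| <= e by rewrite ger0_norm.
have rn : `|rho| <= 201 / 100 by rewrite ger0_norm//; lra.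
have cn := normM_le rn (cos_max th); have sn := normM_le rn (sin_max th).
have q := root2_bounds R; have q0 := root2_gt0 R.
rewrite /Num.Def.normr/= mx_normrE.
apply: bigmax_le => [|[i j] _]; first by rewrite mulr_ge0.
rewrite mxE (ord1 i) /=; case: j => -[|[|[|//]]] j3 /=.
- by rewrite mulrC normM_le.
- have vn : `|(2 * root2 R)^-1| <= 1 / 2.
    have /andP[q1 q2] := q; rewrite ger0_norm ?invr_ge0; last by lra.
    by rewrite div1r lef_pV2 ?posrE//; lra.
  apply: (le_trans (normM_le (normM_le en (normD_le mn cn)) vn)).
  by lra.
- have vn : `|2^-1 : R| <= 1 / 2 by rewrite ger0_norm// div1r.
  apply: (le_trans (normM_le (normM_le en sn) vn)).
  by lra.
Qed.

Theorem three_limit_cycles :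
  limit_cycles_bifurcate 3 (chua_family (cycle_constants R)) (p_minus (cycle_constants R)).
Proof.
(* One choice over all pairs (center, e) produces the families of cycles; [set0] is a dummy for the
   values of e out of range. *)
have /choice[C0 C0P] : forall ie : 'I_3 * R, exists O, 0 < ie.2 -> mu_small (ie.2 ^+ 2) ->
    limit_cycle (cycle_field ie.2) O /\
    forall p, O p -> exists m rho th,
      in_box (center ie.1) m rho /\ p = polar_point ie.2 m rho th.
  move=> [i e] /=; have [e0|ne0] := pselect (0 < e); last by exists set0.
  have [mus|nmus] := pselect (mu_small (e ^+ 2)); last by exists set0.
  have [t [t' nd]] := center_simple_zero i.
  by have [orb orbP] := chua_limit_cycle e0 mus nd; exists orb.
have small : \forall e \near 0^'+, mu_small (e ^+ 2) /\ 0 < e :> R.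
  have e0 : 0 < 1 / 10 ^+ 6 :> R by rewrite divr_gt0// exprn_gt0.
  near=> e; have pe : 0 < e by [].
  split => //; have el : e < 1 / 10 ^+ 6 by near: e; exact: nbhs_right_lt.
  apply/andP; split; first by rewrite exprn_gt0.
  have -> : 1 / 10 ^+ 12 = (1 / 10 ^+ 6) ^+ 2 :> R by field.
  by rewrite lerXn2r ?nnegrE// ltW.
exists (fun i e => C0 (i, e)); split.
  apply: filterS small => e [mus e0].
  split => [i j /= Cij|i]; last exact: (C0P (i, e) e0 mus).1.
  have [[[g [T [_ _ _ _ gE]]] _] Ci] := C0P (i, e) e0 mus.
  have [_ Cj] := C0P (j, e) e0 mus.
  have Op : C0 (i, e) (g 0) by rewrite gE; exists 0.
  have [m [rho [th [bi pi]]]] := Ci _ Op.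
  rewrite /= in Cij; rewrite Cij in Op.
  have [m' [rho' [th' [bj pj]]]] := Cj _ Op.
  apply: center_inj bi bj _.
  have [h _ _] := polar_point_coords e0 m rho th.
  have [h' _ _] := polar_point_coords e0 m' rho' th'.
  by rewrite -h -h' -pi -pj.
move=> i N; rewrite p_minus0 => /nbhs_ballP[r r0 rN].
have r40 : 0 < r / 4 by rewrite divr_gt0.
near=> e; have [mus e0] : mu_small (e ^+ 2) /\ 0 < e by near: e.
have er : e < r / 4 by near: e; exact: nbhs_right_lt.
move=> p /((C0P (i, e) e0 mus).2 _)[m [rho [th [b ->]]]].
have [t [t' nd]] := center_simple_zero i.
apply: rN; rewrite -ball_normE /ball_ /= sub0r normrN.
by rewrite (le_lt_trans (polar_point_norm th (ltW e0) (nd_center nd) b))//; lra.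
Unshelve. all: by end_near. Qed.

End LimitCycles.

(** * Zero-Hopf bifurcation *)

Section Equivalence.
Variable R : realType.
Implicit Types X Y : 'rV[R]_3 -> 'rV[R]_3.

(** The time change is continuous and strictly increasing, so it maps onto a neighborhood of s 0,
    where the image solution is constantly h p; its derivative there is both 0 and Y (h p). *)
Lemma maps_orbits_equilibrium X U Y h p : maps_orbits X U Y h -> U p -> X p = 0 ->
  Y (h p) = 0.
Proof.
move=> mo Up Xp0.
have solp : solves X setT (fun=> p).
  by move=> t _; rewrite Xp0; exact: is_derive_cst.
have sub : (fun=> p) @` [set: R] `<=` U by move=> _ [t _ <-].
have [s [g' [cs incr sol' hs]]] := mo setT (fun=> p) openT (fun _ _ _ _ _ _ => I) solp sub.
have s01 : s (-1) < s 0 by apply: incr => //; lra.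
have s12 : s 0 < s 1 by apply: incr => //; lra.
have g'E : \forall u \near s 0, cst (h p) u = g' u.
  near=> u.
  have u1 : s (-1) < u by near: u; exact: lt_nbhsr.
  have u2 : u < s 1 by near: u; exact: lt_nbhsl.
  have cs' : {within `[-1, 1], continuous s} by apply: continuous_subspaceW cs.
  have le11 : -1 <= 1 :> R by lra.
  have [|t _ <-] := IVT le11 cs' (v := u); last exact: hs.
  by rewrite ge_min le_max (ltW u1) (ltW u2) orbT.
have d1 : is_derive (s 0 : R^o) 1 (g' : R^o -> 'rV[R]_3) (Y (g' (s 0))).
  by apply: sol'; exists 0.
have d2 : is_derive (s 0 : R^o) 1 (g' : R^o -> 'rV[R]_3) 0.
  exact: (near_eq_is_derive g'E (is_derive_cst _ _ _)).
rewrite (hs 0 I); have := @derive_val _ _ _ _ _ _ _ d1.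
by rewrite (@derive_val _ _ _ _ _ _ _ d2).
Unshelve. all: by end_near. Qed.

Lemma equivalent_unique_equilibrium X U Y V p q : topologically_equivalent X U Y V ->
  U p -> U q -> X p = 0 -> X q = 0 -> (forall v, Y v = 0 -> v = 0) -> p = q.
Proof.
move=> [h [k [_ hk _ mo _]]] Up Uq Xp Xq Y0.
have [_ <-] := hk _ Up; have [_ <-] := hk _ Uq.
rewrite (Y0 _ (maps_orbits_equilibrium mo Up Xp)).
by rewrite (Y0 _ (maps_orbits_equilibrium mo Uq Xq)).
Qed.

End Equivalence.

Section ZeroHopf.
Variable R : realType.
Variable c : chua_constants R.
Hypothesis cadm : admissible c.

Let abar0_neq0 : abar0 c != 0. Proof. by case: cadm. Qed.
Let abar1_neq0 : abar1 c != 0.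
Proof. by case: cadm => _; rewrite mulf_eq0 negb_or => /andP[]. Qed.

Let quad (u v w : R) (e : R) := u + e * v + e ^+ 2 * w.

Let quad_continuous u v w : continuous (quad u v w).
Proof.
apply: continuous_addfun; last first.
  under eq_fun do rewrite expr2.
  apply: continuous_mulfun; last exact: continuous_cstfun.
  by apply: continuous_mulfun => x; exact: cvg_id.
apply: continuous_addfun; first exact: continuous_cstfun.
by apply: continuous_mulfun; [move=> x; exact: cvg_id|exact: continuous_cstfun].
Qed.

Let par_a0 : par_a c 0 = abar0 c. Proof. by rewrite /par_a expr0n/= !mul0r !addr0. Qed.
Let par_a10 : par_a1 c 0 = abar1 c. Proof. by rewrite /par_a1 expr0n/= !mul0r !addr0. Qed.
Let par_a20 : par_a2 c 0 = 0. Proof. by rewrite /par_a2 expr0n/= !mul0r !addr0. Qed.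

Let par_a_cvg : par_a c e @[e --> 0^'+] --> abar0 c.
Proof. by rewrite -par_a0; apply: cvg_at_right_filter; exact: quad_continuous. Qed.
Let par_a1_cvg : par_a1 c e @[e --> 0^'+] --> abar1 c.
Proof. by rewrite -par_a10; apply: cvg_at_right_filter; exact: quad_continuous. Qed.
Let par_a2_cvg : par_a2 c e @[e --> 0^'+] --> 0.
Proof.
have : quad 0 (alpha2 c) (xi2 c) e @[e --> 0^'+] --> quad 0 (alpha2 c) (xi2 c) 0.
  by apply: cvg_at_right_filter; exact: quad_continuous.
rewrite (_ : quad 0 _ _ = par_a2 c) ?par_a20//.
by apply/funext => e; rewrite /quad add0r.
Qed.
Let sqr_cvg : (e ^+ 2 : R) @[e --> 0^'+] --> 0.
Proof.
have : quad 0 0 1 e @[e --> 0^'+] --> quad 0 0 1 0.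
  by apply: cvg_at_right_filter; exact: quad_continuous.
rewrite (_ : quad 0 0 1 = fun e => e ^+ 2) ?expr0n//.
by apply/funext => e; rewrite /quad; ring.
Qed.

(** The first term of [par_b] cancels the square of [par_a2]; the sign is thus that of - abar1 zeta0
    for small e. *)
Lemma discrE e : par_a1 c e != 0 -> discr c e = - (4 * e ^+ 2 * (par_a1 c e * zeta0 c)).
Proof. by move=> a1; rewrite /discr /par_b; field. Qed.

Lemma parameters_near : \forall e \near 0^'+,
  [/\ par_a c e != 0, par_a1 c e != 0 & 0 < discr c e].
Proof.
have cz : par_a1 c e * zeta0 c @[e --> 0^'+] --> abar1 c * zeta0 c.
  by apply: cvgM => //; exact: cvg_cst.
have z0 : abar1 c * zeta0 c < 0 by case: cadm.
have na := cvgr_neq0 _ par_a_cvg abar0_neq0; have nz := cvgr_lt _ cz _ z0.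
near=> e.
have e0 : 0 < e by [].
have a1z : par_a1 c e * zeta0 c < 0 by near: e; exact: nz.
have a1 : par_a1 c e != 0 by apply: contraTneq a1z => ->; rewrite mul0r ltxx.
split => //; first by near: e; exact: na.
by rewrite discrE// oppr_gt0 pmulr_rlt0// mulr_gt0// exprn_gt0.
Unshelve. all: by end_near. Qed.

(** A root of b + a2 x + a1 x^2 when sg is 1 or -1; sg = 1 gives [p_minus], and sg = -1 the second
    equilibrium that breaks the equivalence. *)
Definition equilibrium_x (sg e : R) : R :=
  (- par_a2 c e - sg * Num.sqrt (discr c e)) / (2 * par_a1 c e).

Definition equilibrium_point (sg e : R) : 'rV[R]_3 :=
  vec3 (equilibrium_x sg e) (par_b1 c e * equilibrium_x sg e) 0.

Lemma p_minusE e : p_minus c e = equilibrium_point 1 e.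
Proof. by rewrite /p_minus /equilibrium_point /equilibrium_x; congr vec3; ring. Qed.

Lemma equilibrium_point0 sg e : sg ^+ 2 = 1 -> par_a1 c e != 0 -> 0 <= discr c e ->
  chua_family c e (equilibrium_point sg e) = 0.
Proof.
move=> sg2 a1 d0; rewrite /chua_family /chua /equilibrium_point !vec3E.
set x := equilibrium_x sg e.
have x0 : par_b c e + par_a2 c e * x + par_a1 c e * x ^+ 2 = 0.
  have sq : (sg * Num.sqrt (discr c e)) ^+ 2 = par_a2 c e ^+ 2 - 4 * par_a1 c e * par_b c e.
    by rewrite exprMn sg2 mul1r sqr_sqrtr.
  transitivity ((par_b c e * (4 * par_a1 c e) - par_a2 c e ^+ 2
      + (sg * Num.sqrt (discr c e)) ^+ 2) / (4 * par_a1 c e)).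
    by rewrite /x /equilibrium_x; field.
  by rewrite sq; field.
apply/rowP => i; rewrite !mxE; case: i => -[|[|[|//]]] i3 /=.
- transitivity (- par_a c e * x * (par_b c e + par_a2 c e * x + par_a1 c e * x ^+ 2)).
    by ring.
  by rewrite x0 mulr0.
- by rewrite oppr0.
- by ring.
Qed.

Lemma equilibrium_x_cvg sg : equilibrium_x sg e @[e --> 0^'+] --> 0.
Proof.
have a1n : 2 * abar1 c != 0 by rewrite mulf_neq0.
have cd : discr c e @[e --> 0^'+] --> 0.
  have cv : - (4 * e ^+ 2 * (par_a1 c e * zeta0 c)) @[e --> 0^'+] -->
      - (4 * 0 * (abar1 c * zeta0 c)).
    apply: cvgN; apply: cvgM; first by apply: cvgM => //; exact: cvg_cst.
    by apply: cvgM => //; exact: cvg_cst.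
  rewrite mulr0 mul0r oppr0 in cv; apply: cvg_trans cv; apply: near_eq_cvg.
  by apply: filterS parameters_near => e [_ a1 _]; rewrite discrE.
have cs : Num.sqrt (discr c e) @[e --> 0^'+] --> 0.
  by have := continuous_cvg _ (@sqrt_continuous R 0) cd; rewrite sqrtr0 => h; exact: h.
rewrite [X in _ --> X](_ : _ = (- 0 - sg * 0) / (2 * abar1 c)); last first.
  by rewrite oppr0 mulr0 subr0 mul0r.
apply: cvgM; first by apply: cvgB; [exact: cvgN|apply: cvgM => //; exact: cvg_cst].
by apply: cvgV => //; apply: cvgM => //; exact: cvg_cst.
Qed.

Lemma equilibrium_point_cvg sg : equilibrium_point sg e @[e --> 0^'+] --> (0 : 'rV[R]_3).
Proof.
have cb1 : par_b1 c e @[e --> 0^'+] -->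
    (omega c ^+ 2 - 1) / abar0 c + 0 * beta1 c + 0 * zeta1 c.
  apply: cvgD; last by apply: cvgM => //; exact: cvg_cst.
  apply: cvgD; first by apply: cvgM; [exact: cvg_cst|exact: cvgV].
  by apply: cvgM; [apply: cvg_at_right_filter; exact: cvg_id|exact: cvg_cst].
have cx := equilibrium_x_cvg sg.
have -> : equilibrium_point sg = fun e => equilibrium_x sg e *: vec3 1 0 0
     + (par_b1 c e * equilibrium_x sg e) *: vec3 0 1 0.
  apply/funext => e; apply/rowP => i; rewrite !mxE.
  by case: i => -[|[|[|//]]] i3 /=; rewrite ?mulr0 ?mulr1 ?addr0 ?add0r.
rewrite [X in _ --> X](_ : _ = (0 : R) *: vec3 1 0 0
   + (((omega c ^+ 2 - 1) / abar0 c + 0 * beta1 c + 0 * zeta1 c) * 0)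
     *: vec3 0 1 0); last first.
  by rewrite mulr0 !scale0r addr0.
by apply: cvgD; apply: cvgZr_tmp => //; exact: cvgM.
Qed.

Lemma chua_family0E x y z : chua_family c 0 (vec3 x y z) =
  vec3 (abar0 c * (z - abar1 c * x ^+ 3)) (- z) (y - (omega c ^+ 2 - 1) / abar0 c * x).
Proof.
rewrite /chua_family /chua !vec3E par_a0 par_a10 par_a20.
rewrite /par_b /par_b1 /par_b2 par_a0 par_a20.
by rewrite !expr0n/=; congr vec3; ring.
Qed.

Lemma chua_family0_equilibrium v : chua_family c 0 v = 0 -> v = 0.
Proof.
rewrite -[v]vec3_eta chua_family0E => /rowP e.
have := e 0; have := e 1; have := e 2; rewrite !vec3E !mxE.
set x := v 0 0; set y := v 0 1; set z := v 0 2.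
move=> e2 /eqP; rewrite oppr_eq0 => /eqP z0 /eqP.
rewrite z0 sub0r mulf_eq0 (negbTE abar0_neq0)/= oppr_eq0 mulf_eq0 (negbTE abar1_neq0)/=.
rewrite expf_eq0/= => /eqP x0; move: e2; rewrite x0 mulr0 subr0 => ->.
by apply/rowP => i; rewrite !mxE; case: i => -[|[|[|//]]].
Qed.

Lemma topological_change U V : open_nbhs (0 : 'rV[R]_3) U ->
  \forall e \near 0^'+, ~ topologically_equivalent (chua_family c e) U (chua_family c 0) V.
Proof.
move=> oU; have nU : nbhs (0 : 'rV[R]_3) U by exact: open_nbhs_nbhs.
have n1 := equilibrium_point_cvg 1 nU; have n2 := equilibrium_point_cvg (-1) nU.
have pn := parameters_near.
near=> e.
have [_ a1 d0] : [/\ par_a c e != 0, par_a1 c e != 0 & 0 < discr c e].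
  by near: e; exact: pn.
have u1 : U (equilibrium_point 1 e) by near: e; exact: n1.
have u2 : U (equilibrium_point (-1) e) by near: e; exact: n2.
move=> te; have := equivalent_unique_equilibrium te u1 u2 _ _ chua_family0_equilibrium.
rewrite !equilibrium_point0 ?expr1n ?sqrrN ?expr1n// ?ltW// => /(_ erefl erefl).
move=> /rowP/(_ 0); rewrite !vec3E => /eqP.
rewrite -subr_eq0 (_ : _ - _ = - (Num.sqrt (discr c e) / par_a1 c e)); last first.
  by rewrite /equilibrium_x; field.
by rewrite oppr_eq0 mulf_eq0 invr_eq0 (negbTE a1) orbF sqrtr_eq0 leNgt d0.
Unshelve. all: by end_near. Qed.

End ZeroHopf.

(** * Linearization at the origin *)

Section Linearization.
Variable R : realType.
Variable c : chua_constants R.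
Hypothesis cadm : admissible c.

Lemma is_derive_coord (p v : 'rV[R]_3) i :
  is_derive p v (fun q : 'rV[R]_3 => q 0 i : R^o) (v 0 i).
Proof.
have did : derivable (id : 'rV[R]_3 -> 'rV[R]_3) p v by exact: derivable_id.
apply: DeriveDef; first exact: (derivable_mxP _ _ _).1 did 0 i.
by have := derive_mx did; rewrite derive_id => /rowP/(_ i); rewrite mxE => ->.
Qed.

(** Row vector convention: row i is the derivative along the i-th basis vector, and eigenvectors
    multiply from the left. *)
Definition linear_part : 'M[R]_3 :=
  \matrix_(i, j) (vec3 (vec3 0 0 (abar0 c) 0 i) (vec3 0 0 (-1) 0 i)
     (vec3 (- ((omega c ^+ 2 - 1) / abar0 c)) 1 0 0 i)) 0 j.

Let X := chua_family c 0.

Lemma chua_family0_coord v :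
  X v = (abar0 c * (v 0 2 - abar1 c * v 0 0 ^+ 3)) *: vec3 1 0 0
    + ((- v 0 2) *: vec3 0 1 0
    + (v 0 1 - (omega c ^+ 2 - 1) / abar0 c * v 0 0) *: vec3 0 0 1).
Proof.
rewrite -{1}[v]vec3_eta /X chua_family0E; apply/rowP => i; rewrite !mxE.
by case: i => -[|[|[|//]]] i3 /=; rewrite ?mulr0 ?mulr1 ?addr0 ?add0r.
Qed.

Lemma differentiable_chua_family0 : differentiable X (0 : 'rV[R]_3).
Proof.
have -> : X =
   (fun v : 'rV[R]_3 => (abar0 c * (v 0 2 - abar1 c * v 0 0 ^+ 3)) *: vec3 1 0 0) \+
   ((fun v => (- v 0 2) *: vec3 0 1 0) \+
    (fun v => (v 0 1 - (omega c ^+ 2 - 1) / abar0 c * v 0 0) *: vec3 0 0 1)).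
  by apply/funext => v; rewrite chua_family0_coord.
have dc i : differentiable (fun v : 'rV[R]_3 => v 0 i : R^o) (0 : 'rV[R]_3).
  exact: differentiable_coord.
have dk (k : R) : differentiable (fun _ : 'rV[R]_3 => k : R^o) (0 : 'rV[R]_3).
  exact: differentiable_cst.
apply: differentiableD; last apply: differentiableD; apply: differentiableZl.
- apply: differentiableM => //; apply: differentiableB => //.
  apply: differentiableM => //; under eq_fun do rewrite !exprS expr0 mulr1.
  by apply: differentiableM => //; exact: differentiableM.
- exact: differentiableN.
- by apply: differentiableB => //; exact: differentiableM.
Qed.

Lemma jacobian_chua_family0 : 'J X (0 : 'rV[R]_3) = linear_part.
Proof.
apply/matrixP => i j.
have := deriveEjacobian (delta_mx 0 i) differentiable_chua_family0.
rewrite -rowE => /rowP/(_ j); rewrite [RHS]mxE => <-.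
have dX : derivable X (0 : 'rV[R]_3) (delta_mx 0 i).
  exact: diff_derivable differentiable_chua_family0.
rewrite derive_mx// mxE.
have d0 := is_derive_coord 0 (delta_mx 0 i) 0.
have d1 := is_derive_coord 0 (delta_mx 0 i) 1.
have d2 := is_derive_coord 0 (delta_mx 0 i) 2.
have XE k v : X v 0 k = [:: abar0 c * (v 0 2 - abar1 c * v 0 0 ^+ 3); - v 0 2;
   v 0 1 - (omega c ^+ 2 - 1) / abar0 c * v 0 0]`_k.
  by rewrite -{1}[v]vec3_eta /X chua_family0E mxE.
under eq_fun do rewrite XE.
apply: (@derive_val _ _ _ _ _ _ _ _).
case: j => -[|[|[|//]]] j3 /=; apply: is_derive_eq; rewrite !mxE /GRing.scale/=;
 by case: i d0 d1 d2 dX => -[|[|[|//]]] i3 _ _ _ _ /=; rewrite ?mxE /=; ring.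
Qed.

Lemma eigenvalue_linear_part (x y z l : R[i]) : z != 0 \/ x != 0 ->
  real_complex R (abar0 c) * z = l * x -> - z = l * y ->
  y - real_complex R ((omega c ^+ 2 - 1) / abar0 c) * x = l * z ->
  eigenvalue (map_mx (real_complex R) linear_part) l.
Proof.
move=> n0 ex ey ez; apply/eigenvalueP.
exists (\row_(j < 3) [:: x; y; z]`_j).
  apply/rowP => j; rewrite !mxE !big_ord_recl big_ord0 !mxE /=.
  case: j => -[|[|[|//]]] j3 /=; rewrite ?rmorph0 ?rmorph1 ?rmorphN ?rmorph1.
  - by rewrite -ex; ring.
  - by rewrite -ey; ring.
  - by rewrite -ez; ring.
apply/eqP => /rowP v0; have := v0 0; have := v0 2; rewrite !mxE /= => z0 x0.
by case: n0; rewrite ?z0 ?x0 eqxx.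
Qed.

Lemma zero_hopf_origin : zero_hopf_equilibrium X 0.
Proof.
have [a0 aw _] := cadm.
have w0 : omega c != 0 by move: aw; rewrite mulf_eq0 negb_or => /andP[].
split; [|exact: differentiable_chua_family0|].
  apply/rowP => i; rewrite chua_family0_coord !mxE.
  by case: i => -[|[|[|//]]] i3 /=; ring.
exists (omega c) => // J.
have -> : J = map_mx (real_complex R) linear_part by rewrite /J jacobian_chua_family0.
split.
- apply: (@eigenvalue_linear_part 1 (real_complex R ((omega c ^+ 2 - 1) / abar0 c)) 0).
  + by right; rewrite oner_eq0.
  + by rewrite mulr0 mul0r.
  + by rewrite oppr0 mul0r.
  + by rewrite mulr1 subrr mulr0.
(* The eigenvector is (abar0, -1, i omega); its last equation reads -1 - (omega^2 - 1) = (i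
   omega)^2. *)
- apply: (@eigenvalue_linear_part (real_complex R (abar0 c)) (-1) (Complex 0 (omega c))).
  + by left; rewrite eq_complex /= negb_and w0 orbT.
  + by rewrite mulrC.
  + by rewrite mulrN1.
  + apply/eqP; rewrite eq_complex /=; apply/andP; split; apply/eqP; field => //.
- apply: (@eigenvalue_linear_part (real_complex R (abar0 c)) (-1) (Complex 0 (- omega c))).
  + by left; rewrite eq_complex /= negb_and oppr_eq0 w0 orbT.
  + by rewrite mulrC.
  + by rewrite mulrN1.
  + apply/eqP; rewrite eq_complex /=; apply/andP; split; apply/eqP; field => //.
Qed.

End Linearization.

Theorem theorem3 (R : realType) :
  [/\ forall c : chua_constants R, admissible c ->
        (\forall e \near 0^'+,
           [/\ par_a c e != 0, par_a1 c e != 0 & 0 <= discr c e]) /\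
        zero_hopf_bifurcation (chua_family c) (p_minus c),
      exists2 c : chua_constants R, admissible c &
        limit_cycles_bifurcate 3 (chua_family c) (p_minus c) &
      forall k : nat, (1 <= k <= 3)%N ->
        exists2 c : chua_constants R, admissible c &
          limit_cycles_bifurcate k (chua_family c) (p_minus c)].
Proof.
have three := three_limit_cycles R; have adm := cycle_constants_admissible R.
split; last 2 [by exists (cycle_constants R)].
- move=> c cadm; have near_par : \forall e \near 0^'+,
      [/\ par_a c e != 0, par_a1 c e != 0 & 0 <= discr c e].
    by apply: filterS (parameters_near cadm) => e [? ? /ltW].
  split => //; split.
  + by rewrite p_minus0; exact: zero_hopf_origin.
  + apply: filterS near_par => e [_ a1 d0].
    by rewrite p_minusE equilibrium_point0// expr1n.
  + rewrite p_minus0 (_ : p_minus c = equilibrium_point c 1).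
      exact: equilibrium_point_cvg.
    by apply/funext => e; exact: p_minusE.
  (* The obstruction counts equilibria and applies to every open U around the origin, so [W] can be
     the whole space. *)
  + rewrite p_minus0; exists setT; first exact: filterT.
    by move=> U V oU _ _ _; exact: topological_change.
(* The same constants serve for every k: it is enough to keep k of the three cycles. *)
- move=> k /andP[_ k3]; exists (cycle_constants R) => //.
  have [C [Cnear CN]] := three.
  exists (C \o widen_ord k3); split; last by move=> i; exact: CN.
  apply: filterS Cnear => e [Cinj Clc]; split=> [i j /= /Cinj|i]; last exact: Clc.
  by move=> /(congr1 val) /=; exact: val_inj.
Qed.
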